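(* There exist constants $c_1, c_2, \varepsilon_0 > 0$ such that the following two statements hold for the 1-NN model. (Upper bound) There is an embedded root finding algorithm which, for every $0<\varepsilon<\varepsilon_0$ and every $n \in \mathbb{N}$, given $\varepsilon$ and the embedded unlabeled 1-NN tree $T_n^\circ$, runs in time $O(n^2 + \log^2(1/\varepsilon))$ and returns a set $H(\varepsilon,n)$ of vertices with $$|H(\varepsilon,n)| \log |H(\varepsilon,n)| \le c_1 \log(1/\varepsilon),$$ and which satisfies $\liminf_{n\to\infty} \mathbf{P}\{1 \in H(\varepsilon,n)\} \ge 1-\varepsilon$ for every $0<\varepsilon<\varepsilon_0$. (Lower bound) For every $0<\varepsilon<\varepsilon_0$, there is no embedded root finding procedure (of any computational complexity) whose returned sets satisfy $|H(\varepsilon,n)| \log |H(\varepsilon,n)| < c_2 \log(1/\varepsilon)$ for all $n$ and for which $\liminf_{n\to\infty} \mathbf{P}\{1 \in H(\varepsilon,n)\} \ge 1-\varepsilon$.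
   Context: Random nearest neighbor model ($d$-NN process): let $\mathbf{T}^d$ be the $d$-dimensional torus of unit volume, with distance $d(x,y) = \big(\sum_{i=1}^d (\min\{|x_i-y_i|, 1-|x_i-y_i|\})^2\big)^{1/2}$. Vertices $1,2,3,\dots$ arrive sequentially, vertex $i$ being placed at a uniformly random position $x_i \in \mathbf{T}^d$, independently of the previous vertices. For $i \ge 2$, upon arrival vertex $i$ is connected by an edge to the closest vertex among $\{1,\dots,i-1\}$ (almost surely unique; ties are broken arbitrarily). The resulting tree on $\{1,\dots,n\}$ is the $d$-NN tree $T_n$; the root is vertex $1$. The 1-NN model is the case $d=1$. $T_n^\circ$ denotes the corresponding unlabeled tree (arrival times removed). Embedded root finding: the input is $\varepsilon \in (0,1)$, $d$, and the unlabeled tree $T_n^\circ$ embedded in $\mathbf{T}^d$ (the positions of the vertices and the edges between them, but not the arrival times). The output is a set $H(\varepsilon,n)$ of vertices whose size is bounded by a quantity independent of $n$, required to satisfy $\liminf_{n\to\infty}\mathbf{P}\{1\in H(\varepsilon,n)\} \ge 1-\varepsilon$. $\log$ is the natural logarithm, and $0\log 0 = 0$. Running time counts elementary operations; arithmetic, comparisons, evaluation of elementary functions and of distances on real numbers cost one unit each. The constant in $O(\cdot)$ is absolute. *)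

(* Defs.v *)
From HB Require Import structures.
From mathcomp Require Import all_boot all_order all_algebra all_fingroup.
From mathcomp Require Import all_classical all_reals all_analysis.

Set Implicit Arguments.
Unset Strict Implicit.
Unset Printing Implicit Defensive.

Import Order.TTheory GRing.Theory Num.Theory.

Local Open Scope ring_scope.

(** * The 1-NN tree *)

(* Points of the torus of dimension 1 are represented in [0, 1[.  For d = 1
   the Euclidean formula sqrt ((min ...)^2) is the minimum itself. *)
Definition torus_dist (R : realType) (x y : R) : R :=
  Num.min `|x - y| (1 - `|x - y|).

(* Vertices are numbered from 0: vertex [i : 'I_n] is the (i+1)-st arrival. *)
Definition nearest (R : realType) (n : nat) (x : n.-tuple R) (i j : 'I_n) :
    bool :=
  (j < i)%N &&
  [forall k : 'I_n, (k < i)%N ==>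
     (torus_dist (tnth x i) (tnth x j) <= torus_dist (tnth x i) (tnth x k))].

(* Edge sets are symmetric sets of ordered pairs.  The value of [p] at the
   root is irrelevant, since no vertex is smaller than the root. *)
Definition tree_edges (n : nat) (p : 'I_n -> 'I_n) : {set 'I_n * 'I_n} :=
  [set e : 'I_n * 'I_n | ((e.2 < e.1)%N && (p e.1 == e.2))
                      || ((e.1 < e.2)%N && (p e.2 == e.1))]%SET.

(* All the trees that some tie-breaking rule produces from the positions [x],
   listed in order of arrival. *)
Definition is_nn_tree (R : realType) (n : nat) (x : n.-tuple R)
    (E : {set 'I_n * 'I_n}) : Prop :=
  exists p : 'I_n -> 'I_n,
    (forall i : 'I_n, (0 < i)%N -> nearest x i (p i)) /\ E = tree_edges p.

(* The tree T_n, with one fixed tie-breaking rule (ties have probability 0). *)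
Definition nn_parent (R : realType) (n : nat) (x : n.-tuple R) (i : 'I_n) :
    'I_n := odflt i [pick j | nearest x i j].

Definition nn_tree (R : realType) (n : nat) (x : n.-tuple R) :
    {set 'I_n * 'I_n} := tree_edges (nn_parent x).

(** * Embedded unlabeled trees *)

(* An embedded graph on n vertices is presented by positions [x] and edges [E]
   under an arbitrary naming of its vertices by 'I_n.  Two presentations
   describe the same unlabeled embedded graph when they differ by a renaming;
   [s v] is the old name of the vertex whose new name is [v]. *)
Definition rename_pos (R : realType) (n : nat) (s : 'S_n) (x : n.-tuple R) :
    n.-tuple R := [tuple tnth x (s v) | v < n].

Definition rename_edges (n : nat) (s : 'S_n) (E : {set 'I_n * 'I_n}) :
    {set 'I_n * 'I_n} :=
  [set e : 'I_n * 'I_n | (s e.1, s e.2) \in E]%SET.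

(* The embedded unlabeled 1-NN trees: after some renaming (the hidden arrival
   order), a 1-NN tree. *)
Definition is_embedded_nn_tree (R : realType) (n : nat) (x : n.-tuple R)
    (E : {set 'I_n * 'I_n}) : Prop :=
  (forall v : 'I_n, 0 <= tnth x v < 1) /\
  exists s : 'S_n, is_nn_tree (rename_pos s x) (rename_edges s E).

(* A procedure maps presentations to vertex sets. *)
Definition procedure (R : realType) : Type :=
  forall n : nat, n.-tuple R -> {set 'I_n * 'I_n} -> {set 'I_n}.

(* The procedure sees the unlabeled tree only: its output commutes with
   renamings. *)
Definition label_invariant (R : realType) (H : procedure R) : Prop :=
  forall (n : nat) (s : 'S_n) (x : n.-tuple R) (E : {set 'I_n * 'I_n})
    (v : 'I_n),
    (v \in H n (rename_pos s x) (rename_edges s E)) = (s v \in H n x E).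

(* Measurability with respect to the product Borel sigma-algebra on R^n.  It
   must be required of the procedure itself: asking only that the events
   {1 \in H} be measurable in the underlying probability space would admit
   procedures that use nonmeasurable sets of positions, for instance on the
   space where x_1 lies in A and the other x_i outside A, for a set A of inner
   measure 0 and outer measure 1. *)
Definition measurable_procedure (R : realType) (H : procedure R) : Prop :=
  forall (n : nat) (E : {set 'I_n * 'I_n}) (v : 'I_n),
    measurable ([set x : n.-tuple R | v \in H n x E]%classic).

Definition embedded_procedure (R : realType) (H : procedure R) : Prop :=
  label_invariant H /\ measurable_procedure H.

Definition size_log_size (R : realType) (n : nat) (S : {set 'I_n}) : R :=
  #|S|%:R * ln (#|S|%:R).

(** * Random positions and the root finding requirement *)

Definition mutually_independent (d : measure_display) (T : measurableType d)
    (R : realType) (P : probability T R) (X : nat -> {RV P >-> R}) : Prop :=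
  forall (s : seq nat) (A : nat -> set R),
    uniq s -> (forall i, measurable (A i)) ->
    P (\bigcap_(i in [set` s]) (X i @^-1` A i))%classic
    = (\prod_(i <- s) P (X i @^-1` A i)%classic)%E.

Definition uniform_positions (d : measure_display) (T : measurableType d)
    (R : realType) (P : probability T R) (X : nat -> {RV P >-> R}) : Prop :=
  [/\ forall (i : nat) (w : T), 0 <= X i w < 1,
      forall (i : nat) (A : set R), measurable A ->
        distribution P (X i) A = uniform_prob (@ltr01 R) A
    & mutually_independent X].

Definition positions (d : measure_display) (T : measurableType d)
    (R : realType) (P : probability T R) (X : nat -> {RV P >-> R})
    (n : nat) (w : T) : n.-tuple R := [tuple X i w | i < n].

Definition contains_root (n : nat) (S : {set 'I_n}) : bool :=
  [exists v in S, val v == 0%N].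

(* The procedure is run on the presentation naming vertices by arrival order;
   by [label_invariant] the choice of presentation does not matter. *)
Definition finds_root (d : measure_display) (T : measurableType d)
    (R : realType) (P : probability T R) (X : nat -> {RV P >-> R})
    (eps : R) (H : procedure R) : Prop :=
  ((1 - eps)%:E <=
   limn_einf (fun n : nat =>
     P [set w | contains_root
                  (H n (positions X n w) (nn_tree (positions X n w)))]%classic
   ))%E.

(** * Algorithms: while programs over a real random access memory *)

(* The memory consists of infinitely many one-dimensional arrays of naturals
   and of reals, indexed by naturals; a scalar variable is an array that is
   used at index 0 only.  Programs contain rational constants only, so that no
   information can be hidden in a real constant, and the only passage from
   reals to naturals is through comparisons (there is no floor operation). *)
Inductive nexp : Type :=
| NConst of nat
| NRead of nat & nexp
| NAdd of nexp & nexp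
| NSub of nexp & nexp
| NMul of nexp & nexp.

Inductive rexp : Type :=
| RConst of rat
| RRead of nat & nexp
| ROfNat of nexp
| RAdd of rexp & rexp
| RSub of rexp & rexp
| RMul of rexp & rexp
| RDiv of rexp & rexp
| RExp of rexp
| RLn of rexp
| RSqrt of rexp
| RSin of rexp
| RCos of rexp
| RAtan of rexp
| RDist of rexp & rexp.

Inductive bexp : Type :=
| BNLe of nexp & nexp
| BRLe of rexp & rexp
| BNot of bexp
| BAnd of bexp & bexp.

Inductive cmd : Type :=
| Skip
| NWrite of nat & nexp & nexp
| RWrite of nat & nexp & rexp
| Seq of cmd & cmd
| If of bexp & cmd & cmd
| While of bexp & cmd.

Record memory (R : realType) : Type := Memory {
  nmem : nat -> nat -> nat;
  rmem : nat -> nat -> R }.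

Fixpoint neval (R : realType) (m : memory R) (e : nexp) : nat :=
  match e with
  | NConst k => k
  | NRead a i => nmem m a (neval m i)
  | NAdd e1 e2 => neval m e1 + neval m e2
  | NSub e1 e2 => neval m e1 - neval m e2
  | NMul e1 e2 => neval m e1 * neval m e2
  end%N.

Fixpoint reval (R : realType) (m : memory R) (e : rexp) : R :=
  match e with
  | RConst q => ratr q
  | RRead a i => rmem m a (neval m i)
  | ROfNat e1 => (neval m e1)%:R
  | RAdd e1 e2 => reval m e1 + reval m e2
  | RSub e1 e2 => reval m e1 - reval m e2
  | RMul e1 e2 => reval m e1 * reval m e2
  | RDiv e1 e2 => reval m e1 / reval m e2
  | RExp e1 => expR (reval m e1)
  | RLn e1 => ln (reval m e1)
  | RSqrt e1 => Num.sqrt (reval m e1)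
  | RSin e1 => sin (reval m e1)
  | RCos e1 => cos (reval m e1)
  | RAtan e1 => atan (reval m e1)
  | RDist e1 e2 => torus_dist (reval m e1) (reval m e2)
  end.

Fixpoint beval (R : realType) (m : memory R) (b : bexp) : bool :=
  match b with
  | BNLe e1 e2 => (neval m e1 <= neval m e2)%N
  | BRLe e1 e2 => reval m e1 <= reval m e2
  | BNot b1 => ~~ beval m b1
  | BAnd b1 b2 => beval m b1 && beval m b2
  end.

(* Evaluation costs one unit per node of the expression. *)
Fixpoint ncost (e : nexp) : nat :=
  match e with
  | NConst _ => 1
  | NRead _ i => (ncost i).+1
  | NAdd e1 e2 | NSub e1 e2 | NMul e1 e2 => (ncost e1 + ncost e2).+1
  end%N.

Fixpoint rcost (e : rexp) : nat :=
  match e with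
  | RConst _ => 1
  | RRead _ i => (ncost i).+1
  | ROfNat e1 => (ncost e1).+1
  | RExp e1 | RLn e1 | RSqrt e1 | RSin e1 | RCos e1 | RAtan e1 =>
      (rcost e1).+1
  | RAdd e1 e2 | RSub e1 e2 | RMul e1 e2 | RDiv e1 e2 | RDist e1 e2 =>
      (rcost e1 + rcost e2).+1
  end%N.

Fixpoint bcost (b : bexp) : nat :=
  match b with
  | BNLe e1 e2 => (ncost e1 + ncost e2).+1
  | BRLe e1 e2 => (rcost e1 + rcost e2).+1
  | BNot b1 => (bcost b1).+1
  | BAnd b1 b2 => (bcost b1 + bcost b2).+1
  end%N.

Definition upd (V : Type) (f : nat -> nat -> V) (a i : nat) (v : V) :
    nat -> nat -> V :=
  fun a' i' => if (a' == a) && (i' == i) then v else f a' i'.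

(* [exec c m t m']: started in memory [m], the command [c] halts after [t]
   elementary operations in memory [m'].  This relation is deterministic. *)
Inductive exec (R : realType) :
    cmd -> memory R -> nat -> memory R -> Prop :=
| ExecSkip m : exec Skip m 0 m
| ExecNWrite a i e m :
    exec (NWrite a i e) m (ncost i + ncost e).+1
      (Memory (upd (nmem m) a (neval m i) (neval m e)) (rmem m))
| ExecRWrite a i e m :
    exec (RWrite a i e) m (ncost i + rcost e).+1
      (Memory (nmem m) (upd (rmem m) a (neval m i) (reval m e)))
| ExecSeq c1 c2 m t1 m1 t2 m2 :
    exec c1 m t1 m1 -> exec c2 m1 t2 m2 -> exec (Seq c1 c2) m (t1 + t2) m2
| ExecIfTrue b c1 c2 m t m1 :
    beval m b -> exec c1 m t m1 -> exec (If b c1 c2) m (bcost b + t) m1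
| ExecIfFalse b c1 c2 m t m1 :
    ~~ beval m b -> exec c2 m t m1 -> exec (If b c1 c2) m (bcost b + t) m1
| ExecWhileFalse b c m :
    ~~ beval m b -> exec (While b c) m (bcost b) m
| ExecWhileTrue b c m t1 m1 t2 m2 :
    beval m b -> exec c m t1 m1 -> exec (While b c) m1 t2 m2 ->
    exec (While b c) m (bcost b + t1 + t2) m2.

(* Input: the number n of vertices in cell 0 of natural array 0, the adjacency
   matrix by rows in natural array 1, [eps] in cell 0 of real array 0, the
   positions in real array 1; every other cell is 0. *)
Definition input_memory (R : realType) (eps : R) (n : nat) (x : n.-tuple R)
    (E : {set 'I_n * 'I_n}) : memory R :=
  Memory
    (fun a i => match a, i with
       | 0, 0 => n
       | 1, _ => nat_of_bool [exists e in E, i == e.1 * n + e.2]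
       | _, _ => 0
       end%N)
    (fun a i => match a, i with
       | 0%N, 0%N => eps
       | 1%N, _ => nth 0 x i
       | _, _ => 0
       end).

(* Output: the indicator function of the returned set, in natural array 2. *)
Definition output_set (R : realType) (n : nat) (m : memory R) : {set 'I_n} :=
  [set v : 'I_n | nmem m 2 v != 0%N]%SET.

(* On input [eps] and the presentation ([x], [E]), the program halts within
   time [b] and returns the set [S]. *)
Definition returns_within (R : realType) (prog : cmd) (eps : R) (n : nat)
    (x : n.-tuple R) (E : {set 'I_n * 'I_n}) (b : R) (S : {set 'I_n}) : Prop :=
  exists (t : nat) (m : memory R),
    [/\ exec prog (input_memory eps x E) t m, t%:R <= b & output_set n m = S].

(* Main.v *)
Require Import Defs.
From HB Require Import structures.
From mathcomp Require Import all_boot all_order all_algebra all_fingroup.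
From mathcomp Require Import all_classical all_reals all_analysis.
From mathcomp Require Import measurable_realfun zify ring lra.

Set Implicit Arguments.
Unset Strict Implicit.
Unset Printing Implicit Defensive.

Import Order.TTheory GRing.Theory Num.Theory.

Local Open Scope ring_scope.

(** Each vertex [i] other than the root is joined to the vertex that was
nearest to it among those present when it arrived.

Upper bound.  A vertex is [covered] when it is strictly closer to both ends of
some edge than these ends are to each other.  The root is never covered, since
it was present when the later end of the edge chose its neighbour.  Among the
uncovered vertices, the candidates are those that have fewer than [K] other
uncovered vertices in the third of the circle ahead of them, or in the third
behind them; here [K] is the least number with [K ln K >= 4 ln (1 / eps)].

- Size.  Cut the circle into three arcs.  Of the candidates in one arc that see
  few vertices ahead, the first one sees all the others, so that there are at
  most [K] of them; in total at most [6 K] ([card_candidates]).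
- Time.  Covered vertices are found by running through the edges, of which
  there are fewer than [n], and all vertices.  The number [K] need not be
  computed: [k < K] is tested as [k ln k < 4 ln (1 / eps)]
  ([program_returns]).
- Probability.  Measure positions by their offset from the root, in [0, 1[.
  The vertices that have arrived leave an open gap, at first ]0, 1[ with the
  root at both ends.  A new vertex inside the gap is joined to the end closer
  to it and takes the place of that end; its edge covers the part of the circle
  that leaves the gap.  Hence the uncovered vertices outside the gap are among
  the root and the successive ends of the gap ([chain_inv]).  If the gap has
  changed fewer than [K] times, there are too few of these ends to keep the root
  from being a candidate; the same holds if at most [K] changes have reduced the
  gap to length at most 1/3, since one of the two thirds next to the root is
  then outside the gap ([root_candidate]).  Otherwise [K] changes have removed
  less than 2/3 of the circle, so that at least half of them have removed at
  most [4 / (3 K)] each.  Given the past, a new point is uniform on the circle,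
  and the gap is longer than 1/3; so each cut is as short as that with a
  probability of order [1 / K] only.  Quantitatively, the weight
  [theta ^ short * (1 / 2) ^ long], where [short] and [long] count the cuts of
  either kind and [theta = K / 64], is a supermartingale ([expected_weight]);
  after [K] cuts, at least half of them short, it is at least
  [(K / 128) ^ (K / 2) >= 1 / eps] ([heavy_weight]), and this has probability at
  most [eps] by Markov's inequality.

Lower bound.  Let the first [K] vertices occupy consecutive cells of length
[1 / (2 K)], from left to right.  For each [r < K] the orders of arrival
[r, r + 1, ..., K - 1, r - 1, ..., 0] produce the same embedded tree, in which
these vertices form a path, whereas the root is the vertex [r]
([nn_tree_outward]).  A set of fewer than [K] vertices omits one of these [K]
roots.  As the order of arrival is exchangeable, the procedure misses the root
with probability at least that of the cells, [(2 K) ^ - K]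
([root_missed_probability]); this exceeds [eps] when [K ln K] is a small
multiple of [ln (1 / eps)]. *)

(** * Laws of tuples of independent uniform points *)

Local Open Scope classical_set_scope.

Lemma measurable_pred_preimage d (T : measurableType d) (P : T -> bool)
    (b : bool) :
  measurable [set x | P x] -> measurable [set x | P x = b].
Proof.
case: b => // mP; rewrite (_ : [set _ | _] = ~` [set x | P x]).
  exact: measurableC.
by apply/seteqP; split => x /=; case: (P x).
Qed.

(** The tests [P w] split the space into finitely many measurable pieces, one
for each set of passed tests.  Trees and sets of candidates depend on the
positions through finitely many comparisons only, which makes them
measurable. *)
Lemma measurable_finite_family d (T : measurableType d) (W : finType)
    (P : W -> T -> bool) (Q : {set W} -> Prop) :
  (forall w, measurable [set x | P w x]) ->
  measurable [set x | Q [set w | P w x]%SET].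
Proof.
move=> mP.
rewrite (_ : [set _ | _] = \bigcup_(S in [set S | Q S])
   \bigcap_(w in [set: W]) [set x | P w x = (w \in S)]); last first.
  apply/seteqP; split => x /=.
    move=> QS; exists [set w | P w x]%SET => //= w _ /=.
    by rewrite inE.
  move=> [S QS PS]; rewrite (_ : [set w | P w x]%SET = S)//.
  by apply/setP => w; rewrite inE; exact: PS.
apply: fin_bigcup_measurable; first exact: finite_finset.
move=> S _; apply: fin_bigcap_measurable; first exact: finite_finset.
move=> w _; exact: measurable_pred_preimage.
Qed.

Section tuple_boxes.
Context (R : realType) (n : nat).

Definition box (A : 'I_n -> set R) : set (n.-tuple R) :=
  [set t | forall i, A i (tnth t i)].

Definition boxes : set (set (n.-tuple R)) :=
  [set B | exists2 A, (forall i, measurable (A i)) & B = box A].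

Lemma measurable_box A : (forall i, measurable (A i)) -> measurable (box A).
Proof.
move=> mA.
rewrite (_ : box A = \bigcap_(i in [set: 'I_n]) ((@tnth n R)^~ i @^-1` A i)).
  apply: fin_bigcap_measurable; first exact: finite_finset.
  move=> i _; rewrite -[X in measurable X]setTI; exact: measurable_tnth.
by apply/seteqP; split => t /= h i; [move=> _; exact: h|exact: h i I].
Qed.

Lemma boxesE : (measurable : set (set (n.-tuple R))) = <<s boxes >>.
Proof.
apply/seteqP; split.
  apply: smallest_sub; first exact: smallest_sigma_algebra.
  apply: (@subset_trans _ boxes); last exact: sub_gen_smallest.
  rewrite -bigcup_seq; apply: bigcup_sub => i _ B [C mC <-].
  exists (fun j => if j == i then C else setT); first by move=> j; case: ifP.
  apply/seteqP; split => t /=.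
    by move=> [_ Ct] j; case: eqP => // ->.
  by move=> /(_ i); rewrite eqxx.
apply: smallest_sub; first exact: sigma_algebra_measurable.
by move=> _ [A mA ->]; exact: measurable_box.
Qed.

(** Boxes are stable under intersection and generate the product
sigma-algebra; laws of tuples are compared below by the product rule. *)
Lemma tuple_measure_unique (m1 m2 : {measure set (n.-tuple R) -> \bar R}) :
  (m1 setT < +oo)%E ->
  (forall A, (forall i, measurable (A i)) -> m1 (box A) = m2 (box A)) ->
  forall B, measurable B -> m1 B = m2 B.
Proof.
move=> m1oo m12 B mB.
have boxT : box (fun=> setT) = setT by apply/seteqP; split.
apply: (@measure_unique _ _ _ boxes (fun=> setT) boxesE _ _ _ m1 m2) => //.
- move=> _ _ [A mA ->] [C mC ->]; exists (fun i => A i `&` C i).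
    by move=> i; exact: measurableI.
  apply/seteqP; split => t /=; first by move=> [At Ct] i; split.
  by move=> h; split => i; case: (h i).
- by move=> _; exists (fun=> setT) => //; rewrite boxT.
- by rewrite bigcup_const.
- by move=> _ [A mA ->]; exact: m12.
Qed.

End tuple_boxes.

Section uniform_sample.
Context (d : measure_display) (T : measurableType d) (R : realType).
Context (P : probability T R) (X : nat -> {RV P >-> R}).
Hypothesis unifX : uniform_positions X.

Let U := uniform_prob (@ltr01 R).

Lemma positions_preimage n (A : 'I_n -> set R) :
  positions X n @^-1` box A
  = \bigcap_(i in [set` iota 0 n])
      X i @^-1` (\bigcap_(j in [set j : 'I_n | j = i :> nat]) A j).
Proof.
apply/seteqP; split => w /=.
  by move=> h i /= _ j /= <-; have := h j; rewrite tnth_mktuple.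
move=> h j; rewrite tnth_mktuple; apply: (h j) => //=.
by rewrite mem_iota /= ltn_ord.
Qed.

Lemma measurable_positions n :
  measurable_fun [set: T] (positions X n : T -> n.-tuple R).
Proof.
apply/measurable_fun_tnthP => i.
rewrite (_ : _ \o _ = X i); first exact: measurable_funPT.
by apply/funext => w /=; rewrite tnth_mktuple.
Qed.

HB.instance Definition _ n :=
  isMeasurableFun.Build _ _ _ _ (positions X n : T -> n.-tuple R)
    (@measurable_positions n).

Lemma measurable_rename_pos n (s : 'S_n) :
  measurable_fun [set: n.-tuple R] (rename_pos s : _ -> n.-tuple R).
Proof.
apply/measurable_fun_tnthP => i.
rewrite (_ : _ \o _ = (@tnth n R)^~ (s i)); first exact: measurable_tnth.
by apply/funext => w /=; rewrite tnth_mktuple.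
Qed.

Lemma positions_box n (A : 'I_n -> set R) : (forall i, measurable (A i)) ->
  P (positions X n @^-1` box A) = (\prod_(i < n) U (A i))%E.
Proof.
move=> mA.
rewrite positions_preimage.
have [_ uX iX] := unifX.
rewrite iX ?iota_uniq//; last first.
  move=> i; apply: fin_bigcap_measurable => //; exact: finite_finset.
rewrite -{1}(subn0 n) -/(index_iota 0 n) big_mkord; apply: eq_bigr => i _.
rewrite -/(pushforward P (X i) _) -/(distribution P (X i) _) uX.
  congr (U _); apply/seteqP; split => x /=.
    exact.
  by move=> Ax j /= /val_inj ->.
apply: fin_bigcap_measurable => //; exact: finite_finset.
Qed.

(** On a box, both sides are the same product with its factors in a different
order. *)
Lemma positions_exchangeable n (s : 'S_n) (B : set (n.-tuple R)) :
  measurable B ->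
  P ((fun w => rename_pos s (positions X n w)) @^-1` B)
  = P (positions X n @^-1` B).
Proof.
move=> mB.
have mf : measurable_fun [set: T] (rename_pos s \o positions X n).
  by apply: measurableT_comp; [exact: measurable_rename_pos|
    exact: measurable_positions].
pose f : {mfun T >-> n.-tuple R} :=
  HB.pack (rename_pos s \o positions X n) (isMeasurableFun.Build _ _ _ _ _ mf).
apply: (@tuple_measure_unique R n (distribution P f)
  (distribution P (positions X n))) => //.
  apply: (le_lt_trans (probability_le1 (distribution P f) measurableT)).
  exact: ltry.
move=> A mA.
transitivity (\prod_(i < n) U (A ((s^-1)%g i)))%E.
  rewrite -positions_box//; congr (P _); apply/seteqP; split => w /= h i.
    have := h ((s^-1)%g i); by rewrite !tnth_mktuple permKV.
  have := h (s i); by rewrite !tnth_mktuple permK.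
rewrite [RHS]positions_box// [RHS](reindex_inj (@perm_inj _ (s^-1)%g)).
by [].
Qed.

(** Both sides are finite measures in [A], which agree on boxes. *)
Lemma positions_indep n (A : set (n.-tuple R)) (B : set R) :
  measurable A -> measurable B ->
  P (positions X n @^-1` A `&` X n @^-1` B) =
  (P (positions X n @^-1` A) * distribution P (X n) B)%E.
Proof.
move=> mA mB.
have [_ uX iX] := unifX.
have mXB : measurable (X n @^-1` B).
  by rewrite -[X in measurable X]setTI; exact: measurable_funPT.
have UB : (0 <= fine (distribution P (X n) B))%R by rewrite fine_ge0.
pose r : {nonneg R} := NngNum UB.
have -> : (P (positions X n @^-1` A) * distribution P (X n) B =
    mscale r (distribution P (positions X n)) A)%E.
  by rewrite /mscale /= fineK ?fin_num_measure// muleC.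
apply: (@tuple_measure_unique R n
  (pushforward (mrestr P mXB) (positions X n))
  (mscale r (distribution P (positions X n)))) => //.
  apply: (@le_lt_trans _ _ 1%E); last exact: ltry.
  rewrite /= /pushforward /mrestr.
  apply: probability_le1; by rewrite preimage_setT setTI.
move=> C mC; rewrite /= /mscale /= fineK ?fin_num_measure//.
rewrite /pushforward /mrestr [X in (_ * X)%E]positions_box//.
pose D i := if i == n then B else
  \bigcap_(j in [set j : 'I_n | j = i :> nat]) C j.
have mD i : measurable (D i).
  rewrite /D; case: ifP => // _.
  by apply: fin_bigcap_measurable => //; exact: finite_finset.
transitivity (P (\bigcap_(i in [set` iota 0 n.+1]) (X i @^-1` D i))).
  congr (P _); apply/seteqP; split => w /=.
    move=> [h hB] i /= _; rewrite /D; case: eqP => [->//|_] j /= <-.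
    by have := h j; rewrite tnth_mktuple.
  move=> h.
  have {}h i : (i < n.+1)%N -> D i (X i w).
    move=> ni; have /h : i \in iota 0 n.+1 by rewrite mem_iota.
    exact.
  split => [i|]; last by have := h n (ltnSn n); rewrite /D eqxx.
  rewrite tnth_mktuple; have := h i (ltnW (ltn_ord i)).
  by rewrite /D ltn_eqF// => /(_ i); apply.
rewrite iX ?iota_uniq// -{1}(subn0 n.+1) -/(index_iota 0 n.+1) big_mkord.
rewrite big_ord_recr /= muleC; congr (_ * _)%E.
  by rewrite /D eqxx.
apply: eq_bigr => i _.
rewrite -/(pushforward P (X i) _) -/(distribution P (X i) _) uX//.
congr (U _); rewrite /D ltn_eqF//; apply/seteqP; split => x /=.
  by move=> /(_ i); apply.
by move=> Ax j /= /val_inj ->.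
Qed.

Definition positions_next n (w : T) : n.-tuple R * R :=
  (positions X n w, X n w).

Lemma measurable_positions_next n :
  measurable_fun [set: T] (positions_next n).
Proof. by apply: measurable_fun_pair. Qed.

HB.instance Definition _ n :=
  isMeasurableFun.Build _ _ _ _ (positions_next n)
    (@measurable_positions_next n).

(** The next point is independent of the earlier ones, so that the law of the
pair is a product measure, to which Tonelli's theorem applies.  The inner
integral plays the part of a conditional expectation given the past. *)
Lemma integral_positions_next n (f : n.-tuple R * R -> \bar R) :
  measurable_fun setT f -> (forall z, 0 <= f z)%E ->
  (\int[P]_w f (positions_next n w) =
   \int[P]_w \int[distribution P (X n)]_x f (positions X n w, x))%E.
Proof.
move=> mf f0.
rewrite -[LHS](ge0_integral_distribution (positions_next n) mf f0).
pose mu := distribution P (positions X n).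
transitivity (\int[(mu \x distribution P (X n))%E]_z f z)%E.
  apply: eq_measure_integral => A mA _; symmetry.
  apply: product_measure_unique => // B C mB mC.
  by rewrite -[RHS]positions_indep.
rewrite fubini_tonelli1//.
rewrite ge0_integral_distribution//.
  exact: measurable_fun_fubini_tonelli_F.
by move=> y; apply: integral_ge0.
Qed.

End uniform_sample.

(** * Null events *)

Section uniform_law.
Context (R : realType).

Lemma uniform_probE (A : set R) : measurable A ->
  uniform_prob (@ltr01 R) A = lebesgue_measure (A `&` `[0%R, 1%R]).
Proof.
move=> mA; rewrite /uniform_prob integral_uniform_pdf.
rewrite (eq_integral (cst 1%E)); last first.
  move=> x; rewrite inE /= => -[_]; rewrite in_itv /= /uniform_pdf => ->.
  by rewrite subr0 invr1.
by rewrite integral_cst ?mul1e//; apply: measurableI.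
Qed.

Context (d : measure_display) (T : measurableType d).
Context (P : probability T R) (X : nat -> {RV P >-> R}).
Hypothesis unifX : uniform_positions X.

Lemma law_le_itv n (a b : R) : (a <= b)%R ->
  (distribution P (X n) `[a, b] <= (b - a)%:E)%E.
Proof.
have [_ uX _] := unifX => ab.
rewrite uX// uniform_probE//.
apply: (@le_trans _ _ (lebesgue_measure `[a, b])).
  by apply: le_measure; rewrite ?inE//; apply: measurableI.
rewrite lebesgue_measure_itv /=; case: ifP => // _.
by rewrite lee_fin subr_ge0.
Qed.

Lemma law_itv n (x y : bool) (a b : R) : (0 <= a)%R -> (a <= b)%R ->
  (b <= 1)%R ->
  distribution P (X n) [set` Interval (BSide x a) (BSide y b)] = (b - a)%:E.
Proof.
have [_ uX _] := unifX => a0 ab b1.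
rewrite uX// uniform_probE// setIidl.
  rewrite lebesgue_measure_itv /= lte_fin lt_neqAle ab andbT.
  by case: eqP => [->|//]; rewrite subrr.
move=> z /=; rewrite !itv_boundlr /= !bnd_simp => /andP[h1 h2].
rewrite (le_trans a0)/= ?(le_trans _ b1)//.
  by case: y h2 => /=; rewrite bnd_simp // => /ltW.
by case: x h1 => /=; rewrite bnd_simp // => /ltW.
Qed.

Lemma law_countable n (A : set R) : measurable A -> countable A ->
  distribution P (X n) A = 0%E.
Proof.
have [_ uX _] := unifX => mA cA.
rewrite uX// uniform_probE//; apply: countable_lebesgue_measure0.
exact: sub_countable (subset_card_le (@subIsetl _ _ _)) cA.
Qed.

(** The law of the next point has no atoms and does not depend on the past. *)
Lemma positions_next_null n (A : set (n.-tuple R * R)) :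
  measurable A -> (forall t, countable (xsection A t)) ->
  P (positions_next X n @^-1` A) = 0%E.
Proof.
move=> mA cA.
have mI : measurable_fun setT (EFin \o (\1_A : n.-tuple R * R -> R)).
  by apply/measurable_EFinP; exact: measurable_indic.
have mA' : measurable (positions_next X n @^-1` A).
  by rewrite -[X in measurable X]setTI; apply: measurable_positions_next.
rewrite -[X in P X]setIT -integral_indic//.
have := @integral_positions_next _ _ _ _ _ unifX n _ mI.
rewrite /= => ->; last by move=> z; rewrite lee_fin.
apply: integral0_eq => w _.
rewrite (eq_integral (fun x => (\1_(xsection A (positions X n w)) x)%:E)).
  rewrite integral_indic// ?setIT; last exact: measurable_xsection.
  by apply: law_countable => //; exact: measurable_xsection.
by move=> x _; rewrite !indicE mem_xsection.
Qed.

Lemma measurable_nth n i :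
  measurable_fun setT (fun t : n.-tuple R => nth (0 : R) t i).
Proof.
have [ni|ni] := ltnP i n; last first.
  rewrite (_ : (fun _ => _) = cst 0%R)//.
  by apply/funext => t; rewrite nth_default ?size_tuple.
rewrite (_ : (fun _ => _) = (@tnth n R)^~ (Ordinal ni)).
  exact: measurable_tnth.
by apply/funext => t; rewrite (tnth_nth 0%R).
Qed.

Lemma nth_positions n i w : (i < n)%N -> nth 0%R (positions X n w) i = X i w.
Proof.
move=> ni; rewrite -[i]/(nat_of_ord (Ordinal ni)) -tnth_nth.
by rewrite tnth_mktuple.
Qed.

Lemma measurable_torus_dist d' (T' : measurableType d') (f g : T' -> R) :
  measurable_fun setT f -> measurable_fun setT g ->
  measurable_fun setT (fun x => torus_dist (f x) (g x)).
Proof.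
move=> mf mg.
have mn : measurable_fun setT (fun x => `|f x - g x|%R).
  by apply: measurableT_comp => //; exact: measurable_funB.
by apply: measurable_minr => //; exact: measurable_funB.
Qed.

Lemma measurable_ltr_set d' (T' : measurableType d') (f g : T' -> R) :
  measurable_fun setT f -> measurable_fun setT g ->
  measurable [set x | (f x < g x)%R].
Proof.
move=> mf mg; have /(_ measurableT [set true]) := measurable_fun_ltr mf mg.
by rewrite setTI; exact.
Qed.

Lemma measurable_ler_set d' (T' : measurableType d') (f g : T' -> R) :
  measurable_fun setT f -> measurable_fun setT g ->
  measurable [set x | (f x <= g x)%R].
Proof.
move=> mf mg; have /(_ measurableT [set true]) := measurable_fun_ler mf mg.
by rewrite setTI; exact.
Qed.

Lemma measurable_eqr_set d' (T' : measurableType d') (f g : T' -> R) :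
  measurable_fun setT f -> measurable_fun setT g ->
  measurable [set x | (f x == g x)%R].
Proof.
move=> mf mg; have /(_ measurableT [set true]) := measurable_fun_eqr mf mg.
by rewrite setTI; exact.
Qed.

(** A point at equal distances from [a] and [b] is the midpoint of one of the
two arcs between them. *)
Lemma torus_dist_tie (x a b : R) : 0 <= a < 1 -> 0 <= b < 1 -> a != b ->
  torus_dist x a = torus_dist x b ->
  [\/ x = (a + b) / 2, x = (a + b + 1) / 2 | x = (a + b - 1) / 2].
Proof.
rewrite /torus_dist => /andP[a0 a1] /andP[b0 b1] /eqP ab.
case: (lerP 0 (x - a)) => xa; case: (lerP 0 (x - b)) => xb;
rewrite ?(ger0_norm xa) ?(ger0_norm xb) ?(ltr0_norm xa) ?(ltr0_norm xb);
case: leP => _; case: leP => _ e;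
by [exfalso; apply: ab; lra|exfalso; lra|constructor 1; lra|
    constructor 2; lra|constructor 3; lra].
Qed.

Lemma equal_positions_null j i : (j < i)%N ->
  P [set w | X i w = X j w] = 0%E.
Proof.
move=> ji.
pose A := [set z : i.-tuple R * R | z.2 == nth 0 z.1 j].
rewrite (_ : [set _ | _] = positions_next X i @^-1` A); last first.
  apply/seteqP; split => w /=; rewrite /A /= nth_positions//;
  by [move/eqP|move=> /eqP].
apply: positions_next_null.
  apply: measurable_eqr_set => //.
  exact: (measurableT_comp (@measurable_nth i j) measurable_fst).
move=> t; apply: (@sub_countable _ _ _ [set nth 0 t j]); last exact: countable1.
by apply: subset_card_le => x; rewrite /xsection /= inE => /eqP.
Qed.

Lemma tie_null j k i : (j < i)%N -> (k < i)%N ->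
  P [set w | X j w != X k w /\
    torus_dist (X i w) (X j w) = torus_dist (X i w) (X k w)] = 0%E.
Proof.
move=> ji ki; have [X01 _ _] := unifX.
pose c l (z : i.-tuple R * R) : R := nth 0 z.1 l.
pose x (z : i.-tuple R * R) : R := z.2.
have mc l : measurable_fun setT (c l).
  exact: (measurableT_comp (@measurable_nth i l) measurable_fst).
have mx : measurable_fun setT x by exact: measurable_snd.
pose A := [set z | [/\ 0 <= c j z, c j z < 1, 0 <= c k z, c k z < 1 &
  c j z != c k z /\ torus_dist (x z) (c j z) == torus_dist (x z) (c k z)]].
rewrite (_ : [set _ | _] = positions_next X i @^-1` A); last first.
  apply/seteqP; split => w /=; rewrite /A /c /x /= !nth_positions//.
    by move=> [? /eqP ?]; have /andP[] := X01 j w; have /andP[] := X01 k w.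
  by move=> [_ _ _ _ [? /eqP ?]].
apply: positions_next_null.
  rewrite (_ : A = [set z | 0 <= c j z] `&` [set z | c j z < 1]
   `&` [set z | 0 <= c k z] `&` [set z | c k z < 1]
   `&` (~` [set z | c j z == c k z] `&`
     [set z | torus_dist (x z) (c j z) == torus_dist (x z) (c k z)])).
    repeat apply: measurableI;
      by [apply: measurable_ler_set|apply: measurable_ltr_set|
      apply: measurableC; apply: measurable_eqr_set|
      apply: measurable_eqr_set; apply: measurable_torus_dist].
  apply/seteqP; split => z /=.
    by move=> [? ? ? ? [/negP ? ?]].
  by move=> [[[[? ?] ?] ?] [/negP ? ?]].
move=> t; pose a : R := nth 0 t j; pose b : R := nth 0 t k.
apply: (@sub_countable _ _ _
  [set (a + b) / 2; (a + b + 1) / 2; (a + b - 1) / 2]).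
  apply: subset_card_le => y; rewrite /xsection /= inE /A /c /x /= -/a -/b.
  move=> [a0 a1 b0 b1 [ab /eqP e]].
  have := @torus_dist_tie y a b; rewrite a0 a1 b0 b1 => /(_ isT isT ab e).
  by case=> ->; [left; left|left; right|right].
by apply: finite_set_countable; rewrite !finite_setU; split; [split|].
Qed.

Definition distinct n (t : n.-tuple R) : bool :=
  [forall i, forall j, (i != j) ==> (tnth t i != tnth t j)].

Definition tie_free n (t : n.-tuple R) : bool :=
  [forall i : 'I_n, forall j : 'I_n, forall k : 'I_n,
     [&& (j < i)%N, (k < i)%N & j != k] ==>
     (torus_dist (tnth t i) (tnth t j) != torus_dist (tnth t i) (tnth t k))].

Definition generic n (t : n.-tuple R) : bool := distinct t && tie_free t.

Lemma measurable_distinct n : measurable [set t : n.-tuple R | distinct t].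
Proof.
pose p (w : 'I_n * 'I_n) (t : n.-tuple R) := tnth t w.1 == tnth t w.2.
pose Q (S : {set 'I_n * 'I_n}) : Prop :=
  [forall i, forall j, (i != j) ==> ((i, j) \notin S)].
rewrite (_ : [set _ | _] = [set t | Q [set w | p w t]%SET]).
  apply: (@measurable_finite_family _ _ _ p Q) => w.
  by apply: measurable_eqr_set; exact: measurable_tnth.
apply/funext => t /=; congr (is_true _); apply: eq_forallb => i.
by apply: eq_forallb => j; rewrite inE.
Qed.

Lemma measurable_tie_free n : measurable [set t : n.-tuple R | tie_free t].
Proof.
pose p (w : 'I_n * 'I_n * 'I_n) (t : n.-tuple R) :=
  torus_dist (tnth t w.1.1) (tnth t w.1.2)
  == torus_dist (tnth t w.1.1) (tnth t w.2).
pose Q (S : {set 'I_n * 'I_n * 'I_n}) : Prop :=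
  [forall i : 'I_n, forall j : 'I_n, forall k : 'I_n,
     [&& (j < i)%N, (k < i)%N & j != k] ==> ((i, j, k) \notin S)].
rewrite (_ : [set _ | _] = [set t | Q [set w | p w t]%SET]).
  apply: (@measurable_finite_family _ _ _ p Q) => w.
  by apply: measurable_eqr_set; apply: measurable_torus_dist;
    exact: measurable_tnth.
apply/funext => t /=; congr (is_true _); apply: eq_forallb => i.
by apply: eq_forallb => j; apply: eq_forallb => k; rewrite inE.
Qed.

Lemma measurable_generic n : measurable [set t : n.-tuple R | generic t].
Proof.
rewrite (_ : [set _ | _] = [set t | distinct t] `&` [set t | tie_free t]).
  apply: measurableI.
    exact: measurable_distinct.
  exact: measurable_tie_free.
by apply/seteqP; split => t /= => [/andP|[d0 ?]]; last apply/andP.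
Qed.

Lemma measurable_positions_preimage n (B : set (n.-tuple R)) :
  measurable B -> measurable (positions X n @^-1` B).
Proof.
by move=> mB; rewrite -[X in measurable X]setTI; apply: measurable_positions.
Qed.

(** The exceptional set lies in a countable union of coincidences and ties,
each of which fixes the latest point up to finitely many values. *)
Lemma positions_generic n : P (positions X n @^-1` [set t | generic t]) = 1%E.
Proof.
have mX i j : measurable [set w | X i w = X j w].
  rewrite (_ : [set _ | _] = [set w | X i w == X j w]).
    by apply: measurable_eqr_set.
  by apply/seteqP; split => w /= /eqP.
have mt i j k : measurable [set w | X j w != X k w /\
    torus_dist (X i w) (X j w) = torus_dist (X i w) (X k w)].
  rewrite (_ : [set _ | _] = ~` [set w | X j w == X k w] `&` [set w |
     torus_dist (X i w) (X j w) == torus_dist (X i w) (X k w)]).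
    apply: measurableI; first by apply: measurableC; apply: measurable_eqr_set.
    by apply: measurable_eqr_set; apply: measurable_torus_dist.
  by apply/seteqP; split => w /= [/negP ? /eqP ?].
pose N1 := \bigcup_i \bigcup_(j in [set j | (j < i)%N])
  [set w | X i w = X j w].
pose N2 := \bigcup_i \bigcup_j \bigcup_(k in [set k | (j < i)%N /\ (k < i)%N])
  [set w | X j w != X k w /\
    torus_dist (X i w) (X j w) = torus_dist (X i w) (X k w)].
have n1 : P.-negligible N1.
  apply: negligible_bigcup => i; rewrite bigcup_mkcond.
  apply: negligible_bigcup => j.
  case: ifPn => [|_]; last exact: negligible_set0.
  rewrite inE => ji; apply/negligibleP => //.
  exact: equal_positions_null.
have n2 : P.-negligible N2.
  apply: negligible_bigcup => i; apply: negligible_bigcup => j.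
  rewrite bigcup_mkcond; apply: negligible_bigcup => k.
  case: ifPn => [|_]; last exact: negligible_set0.
  rewrite inE => -[ji ki]; apply/negligibleP => //.
  exact: tie_null.
have mg := measurable_positions_preimage (@measurable_generic n).
rewrite -[X in P X]setCK probability_setC; last exact: measurableC.
rewrite (_ : P _ = 0%E) ?sube0//.
apply/negligibleP; first exact: measurableC.
apply: negligibleS (negligibleU n1 n2) => w /=.
move=> ng; apply: contrapT => /not_orP[h1 h2]; apply: ng.
have neq (i j : 'I_n) : i != j -> X i w != X j w.
  wlog ji : i j / (j < i)%N => [H|] ij.
    move: (ij); rewrite neq_ltn => /orP[ltij|ltji]; last exact: H.
    by rewrite eq_sym; apply: H => //; rewrite eq_sym.
  apply/eqP => e; apply: h1; exists i => //; exists j => //.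
apply/andP; split.
  apply/'forall_forallP => i j; apply/implyP => ij.
  by rewrite !tnth_mktuple; exact: neq.
apply/forallP => i; apply/'forall_forallP => j k; apply/implyP.
move=> /and3P[ji ki jk]; rewrite !tnth_mktuple; apply/eqP => e.
apply: h2; exists i => //; exists j => //; exists k => //.
split=> //; exact: neq.
Qed.

End uniform_law.

(** * Trees of points visited outward along a path *)

Local Close Scope classical_set_scope.

Section nearest_neighbour.
Context (R : realType) (n : nat).
Implicit Types (x y : n.-tuple R) (i j : 'I_n).

Lemma nearest_exists x i : (0 < i)%N -> exists j, nearest x i j.
Proof.
move=> i0; have ln := ltn_trans i0 (ltn_ord i).
pose P0 : pred 'I_n := fun k => (k < i)%N.
have P00 : P0 (Ordinal ln) by [].
case: (arg_minP (fun k => torus_dist (tnth x i) (tnth x k)) P00) => j Pj jmin.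
have ji : (j < i)%N by exact: Pj.
exists j; rewrite /nearest ji /=.
by apply/forallP => k; apply/implyP => ki; exact: jmin.
Qed.

Lemma nn_parentP x i : (0 < i)%N -> nearest x i (nn_parent x i).
Proof.
move=> /(nearest_exists x) [j nj]; rewrite /nn_parent.
by case: pickP => [//|/(_ j)]; rewrite nj.
Qed.

Lemma nn_parent_eq x i j : (j < i)%N ->
  (forall k l, nearest x i k -> nearest x i l -> k = l) ->
  (nn_parent x i == j) = nearest x i j.
Proof.
move=> ji uniq_nearest.
have pi : nearest x i (nn_parent x i).
  by apply: nn_parentP; apply: leq_ltn_trans ji.
by apply/eqP/idP => [<-//|nj]; exact: uniq_nearest nj.
Qed.

Lemma tie_free_nearest x i j k : tie_free x ->
  nearest x i j -> nearest x i k -> j = k.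
Proof.
move=> /forallP /(_ i) /'forall_forallP /(_ j k) /implyP tfx.
move=> /andP[ji /forallP minj] /andP[ki /forallP mink].
apply/eqP; apply: contraT => jk.
have := tfx; rewrite ji ki jk => /(_ isT) /negP[].
rewrite eq_le.
have := minj k; rewrite ki => /= ->.
by have := mink j; rewrite ji => /= ->.
Qed.

End nearest_neighbour.

Lemma torus_distC (R : realType) (a b : R) : torus_dist a b = torus_dist b a.
Proof. by rewrite /torus_dist distrC. Qed.

Section path_orders.
Context (R : realType) (n K : nat).
Hypothesis Kn : (K <= n)%N.

(** The path 0, ..., [K.-1] is visited from [r] upwards, then from [r.-1]
downwards; later arrivals keep their rank.  The value [outward r i] is the
place of the arrival of rank [i]. *)
Definition outward (r i : nat) : nat :=
  if (i < K - r)%N then (r + i)%N else if (i < K)%N then (K.-1 - i)%N else i.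

Lemma outward_lo r i : (i < K - r)%N -> outward r i = (r + i)%N.
Proof. by rewrite /outward => ->. Qed.

Lemma outward_hi r i : (K - r <= i)%N -> (i < K)%N ->
  outward r i = (K.-1 - i)%N.
Proof. by move=> ihi iK; rewrite /outward ltnNge ihi /= iK. Qed.

Lemma outward_far r i : (K <= i)%N -> outward r i = i.
Proof.
move=> Ki; rewrite /outward ltnNge (leq_trans (leq_subr r K) Ki).
by rewrite ltnNge Ki.
Qed.

Variant outward_spec r i : nat -> Type :=
| OutwardLo of (i < K - r)%N : outward_spec r i (r + i)
| OutwardHi of (K - r <= i)%N & (i < K)%N : outward_spec r i (K.-1 - i)
| OutwardFar of (K <= i)%N : outward_spec r i i.

Lemma outwardP r i : outward_spec r i (outward r i).
Proof.
have [ilo|ihi] := ltnP i (K - r).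
  by rewrite outward_lo//; constructor.
have [iK|Ki] := ltnP i K; first by rewrite outward_hi//; constructor.
by rewrite outward_far//; constructor.
Qed.

Definition adjacent (i j : nat) : bool := (i == j.+1) || (j == i.+1).

Lemma outward_ltK r i : (outward r i < K)%N = (i < K)%N.
Proof. by case: outwardP; lia. Qed.

(** The visited places form an interval, and the next one is adjacent to it. *)
Lemma outward_neighbour r i : (0 < i)%N -> (i < K)%N ->
  exists2 j, (j < i)%N & adjacent (outward r i) (outward r j).
Proof.
move=> i0 iK; rewrite /adjacent.
have [ilo|ihi|ie] := ltngtP i (K - r).
- by exists i.-1; rewrite ?outward_lo//; lia.
- by exists i.-1; rewrite ?outward_hi//; lia.
- exists 0%N => //; rewrite outward_hi ?ie ?leqnn//; last by lia.
  by rewrite outward_lo; lia.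
Qed.

(** Since the new place [outward r i] is outside the interval visited so far,
its neighbour lies between it and every other visited place. *)
Lemma outward_beyond r i j k : (i < K)%N -> (j < i)%N -> (k < i)%N ->
  j != k -> adjacent (outward r i) (outward r k) ->
  (outward r j < outward r k /\ outward r k < outward r i)%N \/
  (outward r i < outward r k /\ outward r k < outward r j)%N.
Proof.
rewrite /adjacent => iK ji ki jk.
by case: (outwardP r i) => ?; case: (outwardP r j) => ?;
  case: (outwardP r k) => ?; lia.
Qed.

Lemma outward_injn r i j : outward r i = outward r j -> i = j.
Proof. by case: (outwardP r i) => ?; case: (outwardP r j) => ?; lia. Qed.

Lemma outward_lt r (i : 'I_n) : (outward r i < n)%N.
Proof. by have := ltn_ord i; case: outwardP; lia. Qed.

Lemma outward_inj r : injective (fun i : 'I_n => Ordinal (outward_lt r i)).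
Proof. by move=> i j [] /outward_injn /val_inj. Qed.

Definition outward_perm r : 'S_n := perm (@outward_inj r).

Lemma outward_permE r i : outward_perm r i = outward r i :> nat.
Proof. by rewrite permE. Qed.

Lemma outward_perm0 : outward_perm 0 = 1%g.
Proof.
apply/permP => i; apply: val_inj; rewrite perm1 /= outward_permE.
by case: outwardP; lia.
Qed.

(** The cells fill only half of the circle, so that the distance of two points
in them is the difference of their coordinates. *)
Definition in_cells (y : n.-tuple R) : Prop :=
  forall i : 'I_n, (i < K)%N ->
    i%:R / (2 * K)%:R <= tnth y i < i.+1%:R / (2 * K)%:R.

Context (y : n.-tuple R) (ycells : in_cells y).

Lemma cells_lt (i j : 'I_n) : (i < j)%N -> (j < K)%N -> tnth y i < tnth y j.
Proof.
move=> ij jK; have iK := ltn_trans ij jK.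
have /andP[_ yi] := ycells iK; have /andP[yj _] := ycells jK.
apply: lt_le_trans yi (le_trans _ yj).
by rewrite ler_wpM2r ?invr_ge0// ler_nat.
Qed.

Lemma cells_dist (i j : 'I_n) : (i < j)%N -> (j < K)%N ->
  torus_dist (tnth y i) (tnth y j) = tnth y j - tnth y i.
Proof.
move=> ij jK; have iK := ltn_trans ij jK.
have /andP[yi _] := ycells iK; have /andP[_ yj] := ycells jK.
have lt_ij := cells_lt ij jK.
have K0 : (0 < K)%N by apply: leq_ltn_trans jK.
have i0 : 0 <= tnth y i by apply: le_trans yi; rewrite divr_ge0.
have j1 : tnth y j < 2^-1.
  apply: lt_le_trans yj _; rewrite natrM invfM mulrCA mulrC -[leRHS]mul1r.
  by rewrite ler_wpM2r ?invr_ge0// ler_pdivrMr ?ltr0n// mul1r ler_nat.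
rewrite /torus_dist ltr0_norm ?subr_lt0// opprB.
by rewrite min_l//; lra.
Qed.

Lemma nearest_path r (a b : 'I_n) : (a < K)%N -> (b < a)%N ->
  nearest (rename_pos (outward_perm r) y) a b =
  adjacent (outward_perm r a) (outward_perm r b).
Proof.
move=> aK ba; rewrite /nearest ba /=; set s := outward_perm r.
have sE i : s i = outward r i :> nat by exact: outward_permE.
have nK (i : 'I_n) : (i <= a)%N -> (s i < K)%N.
  by move=> ia; rewrite sE outward_ltK; exact: leq_ltn_trans aK.
have saK := nK a (leqnn a).
have closer (c k : 'I_n) : (c < a)%N -> (k < a)%N -> k != c ->
    adjacent (s a) (s c) ->
    torus_dist (tnth y (s a)) (tnth y (s c)) <
    torus_dist (tnth y (s a)) (tnth y (s k)).
  move=> ca ka kc adj.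
  have cK := nK c (ltnW ca); have kK := nK k (ltnW ka).
  have := @outward_beyond r a k c aK ka ca kc.
  rewrite -!sE => /(_ adj) [[sks scs]|[scs sks]].
    rewrite torus_distC [ltRHS]torus_distC !cells_dist//; last first.
      exact: ltn_trans scs.
    by have := cells_lt sks cK; lra.
  rewrite !cells_dist//; last exact: ltn_trans sks.
  by have := cells_lt sks kK; lra.
apply/forallP/idP => [bmin|adj k].
  have [] := @outward_neighbour r a _ aK; first exact: leq_ltn_trans ba.
  move=> c ca; have cn := ltn_trans ca (ltn_ord a).
  rewrite -[c]/(nat_of_ord (Ordinal cn)) -!sE => adj.
  have [<-//|bc] := eqVneq (Ordinal cn) b.
  have := bmin (Ordinal cn); rewrite ca /= !tnth_mktuple -/s leNgt.
  by rewrite closer// eq_sym.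
apply/implyP => ka; rewrite !tnth_mktuple -/s.
have [->//|kb] := eqVneq k b.
by rewrite ltW// closer.
Qed.

Lemma outward_ltn r (a b : 'I_n) : (K <= a)%N ->
  (outward_perm r b < a)%N = (b < a)%N.
Proof.
move=> Ka; rewrite outward_permE.
by case: outwardP; lia.
Qed.

Lemma outward_fix r (a : 'I_n) : (K <= a)%N -> outward_perm r a = a.
Proof.
by move=> Ka; apply: val_inj; rewrite /= outward_permE outward_far.
Qed.

Lemma nearest_beyond r (a b : 'I_n) : (K <= a)%N ->
  nearest (rename_pos (outward_perm r) y) a b = nearest y a (outward_perm r b).
Proof.
move=> Ka; rewrite /nearest outward_ltn//; congr (_ && _).
rewrite !tnth_mktuple outward_fix//; apply/forallP/forallP => minb k.
  have := minb ((outward_perm r)^-1 k)%g; rewrite tnth_mktuple.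
  by rewrite -(outward_ltn r)// permKV.
by have := minb (outward_perm r k); rewrite outward_ltn// tnth_mktuple.
Qed.

(** The edges of the tree described without reference to [r]: a path on the
first [K] points, to which the later points attach as in the order [y]. *)
Definition path_tree_edge (u v : 'I_n) : bool :=
  [|| [&& u < K, v < K & adjacent u v]%N,
      (K <= u)%N && nearest y u v | (K <= v)%N && nearest y v u].

(** Whatever the starting point [r], a vertex of the path is joined to its
neighbour that has been visited ([nearest_path]), and a vertex after the first
[K] finds the same set of predecessors ([nearest_beyond]). *)
Lemma nn_tree_outward r (a b : 'I_n) : tie_free y ->
  ((a, b) \in nn_tree (rename_pos (outward_perm r) y))
  = path_tree_edge (outward_perm r a) (outward_perm r b).
Proof.
move=> tfy; set s := outward_perm r; set x := rename_pos s y.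
have sK i : (s i < K)%N = (i < K)%N by rewrite outward_permE outward_ltK.
have edge (i j : 'I_n) : (j < i)%N ->
    (nn_parent x i == j) = path_tree_edge (s i) (s j).
  move=> ji; have [iK|Ki] := ltnP i K.
    have jK := ltn_trans ji iK.
    rewrite /path_tree_edge [(K <= s i)%N]leqNgt [(K <= s j)%N]leqNgt.
    rewrite !sK iK jK /= orbF.
    rewrite nn_parent_eq//; first by rewrite nearest_path.
    move=> k l nk nl; have /andP[ki _] := nk; have /andP[li _] := nl.
    move: nk nl; rewrite !nearest_path// !outward_permE => nk nl.
    apply/eqP; apply: contraT => kl.
    have := outward_beyond iK ki li kl nl; move: nk; rewrite /adjacent.
    by move: (nl); rewrite /adjacent; lia.
  rewrite nn_parent_eq//; last first.
    move=> k l; rewrite !nearest_beyond// => nk nl.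
    by apply: (@perm_inj _ s); exact: tie_free_nearest nk nl.
  rewrite nearest_beyond// /path_tree_edge [(K <= s i)%N]leqNgt !sK.
  rewrite [(i < K)%N]ltnNge Ki /=.
  rewrite [s i]outward_fix// -/s; case: (nearest y i (s j)) => //=.
  apply/esym/andP => -[_ /andP[]].
  by rewrite -(@outward_ltn r i j)// -/s in ji; lia.
rewrite !inE /=.
have symE u v : path_tree_edge u v = path_tree_edge v u.
  rewrite /path_tree_edge /adjacent andbCA [in LHS]orbC.
  by rewrite [(_ == _.+1) || _]orbC; do 3!case: (_ && _).
case: (ltngtP a b) => [ab|ba|/val_inj ->] /=.
- by rewrite edge// symE.
- by rewrite orbF edge.
- apply/esym/negbTE/negP.
  move=> /or3P[/and3P[_ _]|/andP[_ /andP[]]|/andP[_ /andP[]]];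
    by rewrite ?ltnn// /adjacent; lia.
Qed.

End path_orders.

(** * How often any procedure misses the root *)

Local Open Scope classical_set_scope.

Section measurable_tree.
Context (R : realType) (n : nat).

Lemma measurable_nearest (i j : 'I_n) :
  measurable [set x : n.-tuple R | nearest x i j].
Proof.
pose p (k : 'I_n) (x : n.-tuple R) :=
  torus_dist (tnth x i) (tnth x j) <= torus_dist (tnth x i) (tnth x k).
pose Q (S : {set 'I_n}) : Prop :=
  ((j < i)%N && [forall k : 'I_n, (k < i)%N ==> (k \in S)]).
rewrite (_ : [set _ | _] = [set x | Q [set k | p k x]%SET]).
  apply: (@measurable_finite_family _ _ _ p Q) => k.
  by apply: measurable_ler_set; apply: measurable_torus_dist;
    exact: measurable_tnth.
apply/funext => x /=; congr (is_true (_ && _)); apply: eq_forallb => k.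
by rewrite inE.
Qed.

Lemma measurable_nn_tree (E : {set 'I_n * 'I_n}) :
  measurable [set x : n.-tuple R | nn_tree x = E].
Proof.
pose p (w : 'I_n * 'I_n) (x : n.-tuple R) := nearest x w.1 w.2.
pose Q (S : {set 'I_n * 'I_n}) : Prop :=
  tree_edges (fun i => odflt i [pick j | (i, j) \in S]) = E.
rewrite (_ : [set _ | _] = [set x | Q [set w | p w x]%SET]).
  apply: (@measurable_finite_family _ _ _ p Q) => w.
  exact: (@measurable_nearest w.1 w.2).
apply/funext => x /=; rewrite /Q /nn_tree; congr (tree_edges _ = E).
by apply/funext => i; rewrite /nn_parent; congr (odflt i _);
  apply: eq_pick => j; rewrite inE.
Qed.

Lemma measurable_output (H : procedure R) (v : 'I_n) :
  measurable_procedure H ->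
  measurable [set x : n.-tuple R | v \in H n x (nn_tree x)].
Proof.
move=> mH.
rewrite (_ : [set _ | _] = \bigcup_(E in [set: {set 'I_n * 'I_n}])
    ([set x | nn_tree x = E] `&` [set x | v \in H n x E])).
  apply: fin_bigcup_measurable; first exact: finite_finset.
  by move=> E _; apply: measurableI; [exact: (@measurable_nn_tree E)|exact: mH].
apply/seteqP; split => x /=; first by move=> vH; exists (nn_tree x).
by move=> [E _ [/= ->]].
Qed.

Lemma contains_rootE (n0 : (0 < n)%N) (S : {set 'I_n}) :
  contains_root S = (Ordinal n0 \in S).
Proof.
apply/existsP/idP => [[v /andP[vS /eqP v0]]|vS].
  by rewrite (_ : Ordinal n0 = v)//; apply: val_inj.
by exists (Ordinal n0); rewrite vS /=.
Qed.

Lemma measurable_contains_root (H : procedure R) :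
  (0 < n)%N -> measurable_procedure H ->
  measurable [set x : n.-tuple R | contains_root (H n x (nn_tree x))].
Proof.
move=> n0 mH.
rewrite (_ : [set _ | _] = [set x | Ordinal n0 \in H n x (nn_tree x)]).
  exact: (@measurable_output H).
by apply/funext => x /=; rewrite (contains_rootE n0).
Qed.

Lemma is_embedded_nn_tree_positions (x : n.-tuple R) :
  (forall v : 'I_n, 0 <= tnth x v < 1) -> is_embedded_nn_tree x (nn_tree x).
Proof.
move=> x01; split=> //; exists 1%g.
rewrite (_ : rename_pos _ _ = x); last first.
  by apply: eq_from_tnth => i; rewrite tnth_mktuple perm1.
rewrite (_ : rename_edges _ _ = nn_tree x); last first.
  by apply/setP => -[a b]; rewrite inE !perm1.
by exists (nn_parent x); split => // i; exact: nn_parentP.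
Qed.

End measurable_tree.

Section root_missed.
Context (d : measure_display) (T : measurableType d) (R : realType).
Context (P : probability T R) (X : nat -> {RV P >-> R}).
Hypothesis unifX : uniform_positions X.
Context (n K : nat) (K0 : (0 < K)%N) (Kn : (K <= n)%N).

Let cell (i : 'I_n) : set R := if (i < K)%N
  then `[(i%:R / (2 * K)%:R)%R, (i.+1%:R / (2 * K)%:R)%R[ else setT.

Let measurable_cell i : measurable (cell i).
Proof. by rewrite /cell; case: ifP. Qed.

Lemma probability_cells :
  P (positions X n @^-1` box cell) = ((2 * K)%:R^-1 ^+ K)%:E.
Proof.
rewrite (positions_box unifX)//.
rewrite (eq_bigr (fun i : 'I_n => (if (i < K)%N then (2 * K)%:R^-1 else 1)%:E)).
  rewrite -(big_morph _ (fun x y => EFinM x y) erefl) -big_mkcond /=.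
  by rewrite (big_ord_narrow Kn) prodr_const card_ord.
have [_ uX _] := unifX.
move=> i _; rewrite -(uX 0%N)// /cell; case: ifPn => [iK|_]; last first.
  by rewrite probability_setT.
rewrite (@law_itv _ _ _ _ _ unifX _ true true).
- by rewrite -mulrBl -natrB// subSnn mul1r.
- by rewrite divr_ge0.
- by rewrite ler_wpM2r ?invr_ge0// ler_nat.
- rewrite ler_pdivrMr ?ltr0n ?muln_gt0// mul1r ler_nat.
  by apply: leq_trans iK _; rewrite leq_pmull.
Qed.

Lemma box_cells (y : n.-tuple R) : box cell y -> in_cells K y.
Proof.
by move=> yc i iK; have := yc i; rewrite /cell iK /= in_itv.
Qed.

Context (H : procedure R).
Hypothesis Hemb : embedded_procedure H.
Hypothesis Hsmall : forall (y : n.-tuple R) E,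
  is_embedded_nn_tree y E -> (#|H y E| < K)%N.

(** On the event that the positions lie in the cells, at least one of the [K]
vertices [r] of the path is not returned.  By exchangeability, the event that
[r] is not returned has the probability of an event where the order of arrival
is changed to start from [r], and where the root is therefore missed.  The
latter events are disjoint for different [r], as the first point lies in the
cell [r]. *)
Lemma root_missed_probability :
  (((2 * K)%:R^-1 ^+ K)%:E <= P [set w | ~~ contains_root
     (H (positions X n w) (nn_tree (positions X n w)))])%E.
Proof.
have [Hinv mH] := Hemb; have [X01 _ _] := unifX.
have n0 : (0 < n)%N by exact: leq_trans Kn.
pose s r := outward_perm Kn r.
have root_image r : (r < K)%N -> s r (Ordinal n0) = r :> nat.
  by move=> rK; rewrite outward_permE outward_lo ?addn0// subn_gt0.
pose D := box cell `&` [set t : n.-tuple R | generic t].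
have mD : measurable D.
  by apply: measurableI; [exact: measurable_box|exact: measurable_generic].
pose bad := [set x : n.-tuple R | ~~ contains_root (H x (nn_tree x))].
have mbad : measurable bad.
  rewrite (_ : bad = ~` [set x | contains_root (H x (nn_tree x))]).
    by apply: measurableC; exact: measurable_contains_root.
  by apply/seteqP; split => x /= /negP.
(* E r: the root is missed, and the arrival order that starts from r has been
   applied to points in the cells.  F r: the points are in the cells in the
   original order, and the vertex r is not returned. *)
pose E r := bad `&` rename_pos (s r)^-1%g @^-1` D.
have mE r : measurable (E r).
  apply: measurableI => //; rewrite -[X in measurable X]setTI.
  exact: measurable_rename_pos.
have sK r : cancel (rename_pos (s r)) (@rename_pos R n (s r)^-1%g).
  by move=> y; apply: eq_from_tnth => i; rewrite !tnth_mktuple permKV.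
have sVK r : cancel (@rename_pos R n (s r)^-1%g) (rename_pos (s r)).
  by move=> y; apply: eq_from_tnth => i; rewrite !tnth_mktuple permK.
pose F r := D `&` [set y | s r (Ordinal n0) \notin H y (nn_tree y)].
have mF r : measurable (F r).
  apply: measurableI => //.
  rewrite (_ : [set _ | _] =
      ~` [set y | s r (Ordinal n0) \in H y (nn_tree y)]).
    by apply: measurableC; exact: (@measurable_output R n H _ mH).
  by apply/seteqP; split => x /= /negP.
have treeE r y : D y ->
    rename_edges (s r) (nn_tree y) = nn_tree (rename_pos (s r) y).
  move=> [/box_cells yc /andP[_ tfy]].
  have y0 : rename_pos (outward_perm Kn 0) y = y.
    by apply: eq_from_tnth => i; rewrite tnth_mktuple outward_perm0 perm1.
  apply/setP => -[a b]; rewrite [RHS](nn_tree_outward Kn yc)// finset.in_set /=.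
  by rewrite -[in LHS]y0 (nn_tree_outward Kn yc)// outward_perm0 !perm1.
have PE r : P (positions X n @^-1` E r) = P (positions X n @^-1` F r).
  rewrite -(positions_exchangeable unifX (s r))//; congr (P _).
  apply/seteqP; split => w /=; rewrite /E /F /bad /= sK.
    move=> [nr Dw]; split=> //; apply: contra nr.
    by rewrite (contains_rootE n0) -treeE// Hinv.
  move=> [Dw nr]; split=> //; apply: contra nr.
  by rewrite (contains_rootE n0) -treeE// Hinv.
have mpos B : measurable B -> measurable (positions X n @^-1` B).
  exact: measurable_positions_preimage.
have PD : P (positions X n @^-1` D) = ((2 * K)%:R^-1 ^+ K)%:E.
  rewrite -probability_cells preimage_setI.
  have := positions_generic unifX n.
  set G := positions X n @^-1` [set t | generic t] => PG.
  have mG : measurable G by apply: mpos; exact: measurable_generic.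
  have mC : measurable (positions X n @^-1` box cell).
    by apply: mpos; exact: measurable_box.
  rewrite [RHS](measureDI P mC mG) [X in (X + _)%E](_ : _ = 0%E) ?add0e//.
  apply: (@subset_measure0 _ _ _ P _ (~` G)) => //.
  - exact: measurableD.
  - exact: measurableC.
  - by apply: (etrans (probability_setC P mG)); rewrite PG subee.
rewrite -PD.
apply: (@le_trans _ _ (\sum_(r < K) P (positions X n @^-1` F r))%E).
  apply: (@le_trans _ _
      (P (\big[setU/set0]_(r < K) (positions X n @^-1` F r)))).
    apply: le_measure; rewrite ?inE.
    - exact: mpos.
    - by apply: bigsetU_measurable => r _; apply: mpos.
    - move=> w Dw; rewrite -(bigcup_mkord _ (fun r => _ @^-1` F r)).
      apply: contrapT => nF.
      set y := positions X n w in Dw nF.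
      have /Hsmall : is_embedded_nn_tree y (nn_tree y).
        apply: is_embedded_nn_tree_positions => v.
        by rewrite tnth_mktuple.
      rewrite ltnNge => /negP; apply.
      have inj : injective (fun r : 'I_K => s r (Ordinal n0)).
        by move=> r r' /(congr1 val); rewrite /= !root_image// => /val_inj.
      rewrite -[K in (K <= _)%N]card_ord -(card_imset predT inj).
      apply: subset_leq_card; apply/fintype.subsetP => _ /imsetP[r _ ->].
      by apply: contraT => rH; case: nF; exists r => //=; split.
  exact: (@Boole_inequality _ _ _ P (fun r => positions X n @^-1` F r) K
    (fun r _ => mpos _ (mF r))).
under eq_bigr do rewrite -PE.
rewrite -measure_bigsetU_ord.
- apply: le_measure; rewrite ?inE.
  + by apply: bigsetU_measurable => r _; apply: mpos.
  + exact: (mpos _ mbad).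
  + by move=> w; rewrite -(bigcup_mkord _ (fun r => _ @^-1` E r)) => -[r _ []].
- by move=> r; exact: (mpos _ (mE r)).
- apply/trivIsetP => r r' _ _ rr'.
  apply/seteqP; split=> // w [[_ [c _]] [_ [c' _]]].
  move: c c'; rewrite -/(positions X n w) /= => c c'.
  have inr (k : 'I_K) : box cell (rename_pos (s k)^-1%g (positions X n w)) ->
      k%:R <= X 0%N w * (2 * K)%:R < k.+1%:R.
    move=> /(_ (s k (Ordinal n0))); rewrite /cell root_image// ltn_ord /=.
    rewrite in_itv /= !tnth_mktuple permK /= => /andP[h1 h2].
    by rewrite -ler_pdivrMr ?ltr0n ?muln_gt0 ?K0// -ltr_pdivlMr
      ?ltr0n ?muln_gt0 ?K0// h1 h2.
  have /andP[h1 h2] := inr _ c; have /andP[h3 h4] := inr _ c'.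
  have := le_lt_trans h1 h4; have := le_lt_trans h3 h2.
  rewrite !ltr_nat !ltnS => lr rl; move/eqP: rr'; apply.
  by apply: val_inj; apply/eqP; rewrite eqn_leq lr rl.
Qed.

End root_missed.

(** * The lower bound *)

Local Close Scope classical_set_scope.

Section threshold.
Context (R : realType).
Implicit Types (t : R) (k : nat).

Definition nlogn k : R := k%:R * ln k%:R.

Lemma ln_nat_ge0 k : 0 <= ln k%:R :> R.
Proof. by case: k => [|k]; [rewrite ln0|rewrite ln_ge0// ler1n]. Qed.

Lemma ln_nat_le k l : (k <= l)%N -> ln k%:R <= ln l%:R :> R.
Proof.
case: k => [_|k kl]; first by rewrite [ln 0%:R]ln0// ln_nat_ge0.
by rewrite ler_ln ?posrE ?ltr0n ?ler_nat// (leq_trans _ kl).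
Qed.

Lemma nlogn_le k l : (k <= l)%N -> nlogn k <= nlogn l.
Proof. by move=> kl; rewrite ler_pM ?ler_nat ?ln_nat_ge0 ?ln_nat_le. Qed.

Lemma nlogn_ge0 k : 0 <= nlogn k.
Proof. by rewrite mulr_ge0 ?ln_nat_ge0. Qed.

Lemma ln2_gt0 : 0 < ln 2%:R :> R.
Proof. by rewrite ln_gt0// ltr1n. Qed.

Lemma nlogn_unbounded t : exists k, t <= nlogn k.
Proof.
pose m := (Num.truncn (t / ln 2%:R)).+1; exists m.+1.
have : t / ln 2%:R < m%:R by exact: truncnS_gt.
rewrite ltr_pdivrMr ?ln2_gt0// => /ltW/le_trans; apply.
by rewrite ler_pM ?ln_nat_ge0 ?ler_nat ?ln_nat_le.
Qed.

(** As [nlogn] is nondecreasing, the comparison of a count [k] with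
[threshold t] is the comparison of [nlogn k] with [t], which a program can
evaluate. *)
Definition threshold t : nat := ex_minn (nlogn_unbounded t).

Lemma threshold_leq t k : (threshold t <= k)%N = (t <= nlogn k).
Proof.
rewrite /threshold; case: ex_minnP => m tm minm; apply/idP/idP => [mk|/minm//].
exact: le_trans (nlogn_le mk).
Qed.

Lemma ltn_threshold t k : (k < threshold t)%N = (nlogn k < t).
Proof. by rewrite ltnNge threshold_leq -ltNge. Qed.

Lemma nlognS k : (2 <= k)%N -> nlogn k.+1 <= 3 * nlogn k.
Proof.
move=> k2; rewrite /nlogn.
have lk := ln_nat_ge0 k.
have l2 : ln k.+1%:R <= 2 * ln k%:R :> R.
  rewrite mulr_natl -lnXn ?ltr0n; last by lia.
  rewrite -natrX; apply: ln_nat_le; rewrite expnS expn1; nia.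
have k3 : 2 * k.+1%:R <= 3 * k%:R :> R.
  by rewrite -!natrM ler_nat; lia.
have k0 : 0 <= k%:R :> R by [].
have l0 := ln_nat_ge0 k.+1.
by nra.
Qed.

End threshold.

Local Open Scope classical_set_scope.

Section liminf_bounds.
Context (R : realType).
Local Open Scope ereal_scope.

Lemma limn_einf_le (u : (\bar R)^nat) (N : nat) (c : \bar R) :
  (forall n, (N <= n)%N -> u n <= c) -> limn_einf u <= c.
Proof.
move=> uc; rewrite limn_einf_lim; apply: lime_le; first exact: is_cvg_einfs.
apply: nearW => k; apply: le_trans (uc (maxn k N) (leq_maxr _ _)).
by apply: ereal_inf_lbound; exists (maxn k N) => //=; exact: leq_maxl.
Qed.

Lemma limn_einf_ge (u : (\bar R)^nat) (N : nat) (c : \bar R) :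
  (forall n, (N <= n)%N -> c <= u n) -> c <= limn_einf u.
Proof.
move=> cu; rewrite limn_einf_lim; apply: lime_ge; first exact: is_cvg_einfs.
exists N => // k /= Nk; apply: le_ereal_inf_tmp => _ [m /= km] <-.
by apply: cu; exact: leq_trans km.
Qed.

End liminf_bounds.

Section lower_bound.
Context (d : measure_display) (T : measurableType d) (R : realType).
Context (P : probability T R) (X : nat -> {RV P >-> R}).
Hypothesis unifX : uniform_positions X.

(** With [L = ln (1 / eps)], let [K] be the largest number such that
[K ln K < L / 2].  Then [L / 6 <= K ln K], so that the returned sets have fewer
than [K] elements, and [(2 K) ^ K <= K ^ (2 K) < 1 / eps]. *)
Lemma no_small_procedure (eps : R) :
  0 < eps -> 6 * nlogn R 3 < ln (1 / eps) ->
  ~ exists H : procedure R,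
    [/\ embedded_procedure H,
        forall (n : nat) (x : n.-tuple R) (E : {set 'I_n * 'I_n}),
          (0 < n)%N -> is_embedded_nn_tree x E ->
          size_log_size R (H n x E) < 6^-1 * ln (1 / eps)
      & finds_root X eps H].
Proof.
move=> eps0 epsL [H [Hemb Hsmall Hroot]]; set L := ln (1 / eps) in epsL Hsmall.
pose K := (threshold (L / 2)).-1.
have phi3 := nlogn_ge0 R 3.
have thr4 : (3 < threshold (L / 2))%N by rewrite ltn_threshold; lra.
have KS : K.+1 = threshold (L / 2) by rewrite prednK//; lia.
have K2 : (2 < K)%N by lia.
have phiK : nlogn R K < L / 2 by rewrite -ltn_threshold -KS.
have phiK1 : L / 2 <= nlogn R K.+1 by rewrite -threshold_leq KS.
have LK : L <= 6 * nlogn R K.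
  by have := @nlognS R K (ltnW K2); lra.
have small n (y : n.-tuple R) E : (K <= n)%N ->
    is_embedded_nn_tree y E -> (#|H n y E| < K)%N.
  move=> Kn emb; have n0 : (0 < n)%N by lia.
  rewrite ltnNge; apply/negP => /(@nlogn_le R).
  by have := Hsmall n y E n0 emb; rewrite /size_log_size -/(nlogn R _); lra.
have epsK : eps < (2 * K)%:R^-1 ^+ K.
  have K0 : 0 < (2 * K)%:R :> R by rewrite ltr0n; lia.
  rewrite exprVn -[ltLHS]invrK ltf_pV2 ?posrE ?invr_gt0 ?exprn_gt0//.
  rewrite -ltr_ln ?posrE ?invr_gt0 ?exprn_gt0// lnXn//.
  rewrite -[eps^-1]mul1r -/L.
  have : ln (2 * K)%:R <= 2 * ln K%:R :> R.
    rewrite mulr_natl -lnXn ?ltr0n; last by lia.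
    by rewrite -natrX; apply: ln_nat_le; rewrite expnS expn1; nia.
  rewrite -[ln _ *+ K]mulr_natl => le2.
  have : K%:R * ln (2 * K)%:R <= K%:R * (2 * ln K%:R) :> R.
    exact: (ler_wpM2l (ler0n _ _) le2).
  by move: phiK; rewrite /nlogn; lra.
have : (limn_einf (fun n => P [set w | contains_root
    (H n (positions X n w) (nn_tree (positions X n w)))])
    <= (1 - (2 * K)%:R^-1 ^+ K)%:E)%E.
  apply: (@limn_einf_le R _ K) => n Kn.
  have n0 : (0 < n)%N by lia.
  set A := [set w | _].
  have mA : measurable A.
    exact: (measurable_positions_preimage X
      (@measurable_contains_root R n H n0 (proj2 Hemb))).
  have K0 : (0 < K)%N by lia.
  have := root_missed_probability unifX K0 Kn Hemb
    (fun y E => small n y E Kn).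
  rewrite (_ : [set w | ~~ _] = ~` A); last first.
    by apply/seteqP; split => w /= /negP.
  rewrite probability_setC//.
  have [p ->] : exists p, P A = p%:E.
    by exists (fine (P A)); rewrite fineK// fin_num_measure.
  by rewrite -EFinB !lee_fin !lerBrDr [X in X <= 1 -> _]addrC.
apply/negP; rewrite -ltNge; apply: lt_le_trans Hroot.
by rewrite lte_fin ltrD2l ltrN2.
Qed.

End lower_bound.

(** * The candidates for the root *)

Local Close Scope classical_set_scope.

Section candidates.
Context (R : realType).

(** The length of the arc from [a] to [b] in the positive direction. *)
Definition offset (a b : R) : R := if a <= b then b - a else b - a + 1.

Context (K : nat).

Section graph.
Context (n : nat) (x : n.-tuple R) (E : {set 'I_n * 'I_n}).

Definition closer (a v b : 'I_n) : bool :=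
  torus_dist (tnth x a) (tnth x v) < torus_dist (tnth x a) (tnth x b).

(** The position of [v] lies in the intersection of the two balls that have
their centre at one end of an edge and their boundary through the other. *)
Definition covered (v : 'I_n) : bool :=
  [exists e in E, closer e.1 v e.2 && closer e.2 v e.1].

Definition ahead (v w : 'I_n) : bool := offset (tnth x v) (tnth x w) < 1 / 3%:R.

Definition seen_ahead (v : 'I_n) : {set 'I_n} :=
  [set w | [&& ~~ covered w, w != v & ahead v w]].

Definition seen_behind (v : 'I_n) : {set 'I_n} :=
  [set w | [&& ~~ covered w, w != v & ahead w v]].

End graph.

(** The root, which is never covered, fails to be a candidate only if many
vertices on both of its sides remain uncovered, which is unlikely since the
arrivals next to it tend to cover a fixed proportion of what is left of the
circle. *)
Definition candidates : procedure R := fun n x E =>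
  [set v | ~~ covered x E v &&
     ((#|seen_ahead x E v| < K)%N || (#|seen_behind x E v| < K)%N)]%SET.

Lemma covered_rename n (s : 'S_n) (x : n.-tuple R) E v :
  covered (rename_pos s x) (rename_edges s E) v = covered x E (s v).
Proof.
apply/existsP/existsP => -[e /andP[eE cl]].
  exists (s e.1, s e.2); move: eE cl.
  by rewrite inE => ->; rewrite /closer !tnth_mktuple.
exists ((s^-1)%g e.1, (s^-1)%g e.2); rewrite inE /= !permKV.
by rewrite -surjective_pairing eE /closer !tnth_mktuple !permKV.
Qed.

Lemma label_invariant_candidates : label_invariant candidates.
Proof.
move=> n s x E v; rewrite !inE covered_rename; congr (_ && _).
have card_rename (p q : pred 'I_n) : p =1 (fun w => q (s w)) ->
    #|[set w | p w]%SET| = #|[set w | q w]%SET|.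
  move=> pq; rewrite -(card_imset _ (@perm_inj _ s)); apply: eq_card => w.
  apply/imsetP/idP => [[u + ->]|]; first by rewrite !inE pq.
  by rewrite inE => qw; exists ((s^-1)%g w); rewrite ?inE ?pq permKV.
congr ((_ < K)%N || (_ < K)%N); apply: card_rename => w;
  by rewrite covered_rename (inj_eq (@perm_inj _ s)) /ahead !tnth_mktuple.
Qed.

Lemma measurable_offset d (T : measurableType d) (f g : T -> R) :
  measurable_fun setT f -> measurable_fun setT g ->
  measurable_fun setT (fun t => offset (f t) (g t)).
Proof.
move=> mf mg; apply: measurable_fun_ifT.
- exact: measurable_fun_ler.
- exact: measurable_funB.
- by apply: measurable_funD => //; exact: measurable_funB.
Qed.

(** The candidates are determined by the comparisons in [closer] and
[ahead]. *)
Lemma measurable_candidates : measurable_procedure candidates.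
Proof.
move=> n E v.
pose W := ('I_n * 'I_n * 'I_n + 'I_n * 'I_n)%type.
pose p (w : W) (x : n.-tuple R) := match w with
  | inl t => closer x t.1.1 t.1.2 t.2
  | inr t => ahead x t.1 t.2
  end.
pose Scov (S : {set W}) w :=
  [exists e in E, (inl (e.1, w, e.2) \in S) && (inl (e.2, w, e.1) \in S)].
pose Q (S : {set W}) : Prop := ~~ Scov S v &&
  ((#|[set w | [&& ~~ Scov S w, w != v & inr (v, w) \in S]]%SET| < K)%N ||
   (#|[set w | [&& ~~ Scov S w, w != v & inr (w, v) \in S]]%SET| < K)%N).
rewrite (_ : mkset _ = [set x | Q [set w | p w x]%SET]%classic).
  apply: (@measurable_finite_family _ _ _ p Q) => -[[[a b] c]|[a b]] /=.
    by apply: measurable_ltr_set; apply: measurable_torus_dist;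
      exact: measurable_tnth.
  apply: measurable_ltr_set => //.
  by apply: measurable_offset; exact: measurable_tnth.
apply/funext => x /=; rewrite inE /Q.
have cov w : Scov [set w | p w x]%SET w = covered x E w.
  by apply: eq_existsb => e; rewrite !inE.
rewrite !cov; congr (is_true (_ && ((_ < K)%N || (_ < K)%N)));
  by apply: eq_card => w; rewrite !inE !cov.
Qed.

(** Of the vertices in one third of [0, 1[ that belong to the set because they
see few vertices ahead, the leftmost sees all the others; of those that see few
vertices behind, the rightmost does. *)
Lemma card_candidates n (x : n.-tuple R) (E : {set 'I_n * 'I_n}) :
  (forall v, 0 <= tnth x v < 1) -> (#|candidates x E| <= 6 * K)%N.
Proof.
move=> x01.
pose third (j : 'I_3) v := j%:R / 3%:R <= tnth x v < j.+1%:R / 3%:R.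
pose A (j : 'I_3) :=
  [set v | [&& ~~ covered x E v, (#|seen_ahead x E v| < K)%N & third j v]]%SET.
pose B (j : 'I_3) :=
  [set v | [&& ~~ covered x E v, (#|seen_behind x E v| < K)%N & third j v]]%SET.
have gap j v w : third j v -> third j w -> tnth x v <= tnth x w -> ahead x v w.
  by move=> /andP[v1 v2] /andP[w1 w2] vw; rewrite /ahead /offset vw; lra.
have A_le j : (#|A j| <= K)%N.
  have [->|[v0 v0A]] := set_0Vmem (A j); first by rewrite cards0.
  case: (arg_minP (tnth x) v0A) => v vA vmin.
  have {}vA : v \in A j by exact: vA.
  move: (vA); rewrite inE => /and3P[_ vK tv].
  rewrite (cardsD1 v) vA; apply: leq_trans vK; rewrite add1n ltnS.
  apply: subset_leq_card; apply/fintype.subsetP => w.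
  rewrite in_setD1 => /andP[wv wA]; move: (wA); rewrite inE.
  by move=> /and3P[cw _ tw]; rewrite inE cw wv; apply: gap tv tw (vmin w wA).
have B_le j : (#|B j| <= K)%N.
  have [->|[v0 v0B]] := set_0Vmem (B j); first by rewrite cards0.
  case: (arg_maxP (tnth x) v0B) => v vB vmax.
  have {}vB : v \in B j by exact: vB.
  move: (vB); rewrite inE => /and3P[_ vK tv].
  rewrite (cardsD1 v) vB; apply: leq_trans vK; rewrite add1n ltnS.
  apply: subset_leq_card; apply/fintype.subsetP => w.
  rewrite in_setD1 => /andP[wv wB]; move: (wB); rewrite inE.
  by move=> /and3P[cw _ tw]; rewrite inE cw wv; apply: gap tw tv (vmax w wB).
have sub : candidates x E \subset
    (\bigcup_j A j) :|: (\bigcup_j B j).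
  apply/fintype.subsetP => v; rewrite inE => /andP[cv vK].
  have [j tj] : exists j, third j v.
    have /andP[v0 v1] := x01 v; rewrite /third.
    have [lt1|ge1] := ltP (tnth x v) (1 / 3%:R).
      by exists ord0; apply/andP; split => /=; lra.
    have [lt2|ge2] := ltP (tnth x v) (2%:R / 3%:R).
      by exists (Ordinal (isT : 1 < 3)%N); apply/andP; split => /=; lra.
    by exists ord_max; apply/andP; split => /=; lra.
  rewrite inE; apply/orP; case/orP: vK => vK; [left|right];
    by apply/bigcupP; exists j => //; rewrite inE cv vK tj.
apply: leq_trans (subset_leq_card sub) _.
apply: leq_trans (leq_card_setU _ _) _.
have card_union (F : 'I_3 -> {set 'I_n}) :
    (forall j, #|F j| <= K)%N -> (#|\bigcup_j F j| <= 3 * K)%N.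
  move=> FK; rewrite !big_ord_recl big_ord0 finset.setU0 /=.
  rewrite (_ : 3 * K = K + (K + K))%N; last by lia.
  apply: leq_trans (leq_card_setU _ _) (leq_add (FK _) _).
  exact: leq_trans (leq_card_setU _ _) (leq_add (FK _) (FK _)).
rewrite (_ : 6 * K = 3 * K + 3 * K)%N; last by lia.
by rewrite leq_add ?card_union.
Qed.

End candidates.

(** * The gap around the root *)

Section gap_chain.
Context (R : realType) (K : nat) (eta : R).

(** The gap ]lo, hi[ is an interval of offsets from the root; [short] and [long]
count the vertices that have cut off at most [eta], respectively more than
[eta], from it. *)
Record gap_state : Type := Gap {
  lo : R; hi : R; short : nat; long : nat }.

(** The process is stopped when the gap has become short, which makes the root a
candidate, or after [K] cuts.  Until then, a uniform point falls into the gap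
with probability greater than 1/3. *)
Definition active (s : gap_state) : bool :=
  (1 / 3%:R < hi s - lo s) && (short s + long s < K)%N.

Definition shrink (s : gap_state) (l h cut : R) : gap_state :=
  if cut <= eta then Gap l h (short s).+1 (long s)
  else Gap l h (short s) (long s).+1.

(** The end of the gap that is closer to the new point [t] moves to [t]. *)
Definition gap_step (s : gap_state) (t : R) : gap_state :=
  if active s && (lo s < t < hi s) then
    if t - lo s < hi s - t then shrink s t (hi s) (t - lo s)
    else shrink s (lo s) t (hi s - t)
  else s.

Fixpoint gap_chain (y : nat -> R) (k : nat) : gap_state :=
  if k is k'.+1 then gap_step (gap_chain y k') (y k') else Gap 0 1 0 0.

Lemma lo_shrink s l h cut : lo (shrink s l h cut) = l.
Proof. by rewrite /shrink; case: ifP. Qed.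

Lemma hi_shrink s l h cut : hi (shrink s l h cut) = h.
Proof. by rewrite /shrink; case: ifP. Qed.

Lemma count_shrink s l h cut :
  (short (shrink s l h cut) + long (shrink s l h cut) =
   (short s + long s).+1)%N.
Proof. by rewrite /shrink; case: ifP => _ /=; rewrite ?addSn ?addnS. Qed.

Lemma long_shrink s l h cut : 0 <= cut ->
  (long (shrink s l h cut))%:R * eta <= (long s)%:R * eta + cut.
Proof.
move=> cut0; rewrite /shrink.
case: (leP cut eta) => [_|/ltW ec] /=; first by lra.
by rewrite mulrS mulrDl mul1r; lra.
Qed.

End gap_chain.

Section offsets.
Context (R : realType).
Implicit Types (a b c t : R).

Lemma offset_ge0_lt1 a b : 0 <= a < 1 -> 0 <= b < 1 -> 0 <= offset a b < 1.
Proof.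
move=> /andP[a0 a1] /andP[b0 b1]; rewrite /offset.
by case: (leP a b) => ab; apply/andP; split; lra.
Qed.

Lemma offsetxx a : offset a a = 0.
Proof. by rewrite /offset lexx subrr. Qed.

Lemma offset_swap a b : a != b -> offset b a = 1 - offset a b.
Proof.
rewrite /offset => /eqP ab.
by case: (leP a b) => ?; case: (leP b a) => ?; lra.
Qed.

Lemma offset_inj a b c : 0 <= a < 1 -> 0 <= b < 1 -> 0 <= c < 1 ->
  offset a b = offset a c -> b = c.
Proof.
move=> /andP[a0 a1] /andP[b0 b1] /andP[c0 c1]; rewrite /offset.
by case: (leP a b) => ?; case: (leP a c) => ?; lra.
Qed.

(** A rotation preserves distances. *)
Lemma torus_dist_offset c a b : 0 <= a < 1 -> 0 <= b < 1 -> 0 <= c < 1 ->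
  torus_dist (offset c a) (offset c b) = torus_dist a b.
Proof.
move=> /andP[a0 a1] /andP[b0 b1] /andP[c0 c1]; rewrite /torus_dist /offset.
case: (leP c a) => ca; case: (leP c b) => cb.
- by rewrite (_ : a - c - (b - c) = a - b)//; lra.
- have ab : 0 <= a - b by lra.
  rewrite (ger0_norm ab) ler0_norm; last by lra.
  by rewrite minC; congr (Num.min _ _); lra.
- have ab : a - b <= 0 by lra.
  rewrite (ler0_norm ab) ger0_norm; last by lra.
  by rewrite minC; congr (Num.min _ _); lra.
- by rewrite (_ : a - c + 1 - (b - c + 1) = a - b)//; lra.
Qed.

Lemma torus_dist_le_compl a b : torus_dist a b <= 1 - `|a - b|.
Proof. by rewrite /torus_dist ge_min lexx orbT. Qed.

Lemma torus_dist_short a b : a <= b -> b - a <= 1 / 2%:R ->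
  torus_dist a b = b - a.
Proof.
move=> ab ba; rewrite /torus_dist ler0_norm ?opprB; last by lra.
by rewrite min_l; lra.
Qed.

End offsets.

Section chain_structure.
Context (R : realType) (K : nat) (eta : R) (n : nat) (x : n.-tuple R).
Hypothesis n0 : (0 < n)%N.
Hypothesis x01 : forall v, 0 <= tnth x v < 1.
Hypothesis genx : generic x.

Let root : 'I_n := Ordinal n0.
Let y (i : 'I_n) : R := offset (tnth x root) (tnth x i).

Definition root_offset (i : nat) : R := offset (nth 0 x 0) (nth 0 x i).

Let yE (i : 'I_n) : root_offset i = y i.
Proof. by rewrite /root_offset /y !(tnth_nth 0). Qed.

Let y01 i : 0 <= y i < 1. Proof. exact: offset_ge0_lt1. Qed.

Let y_root : y root = 0. Proof. exact: offsetxx. Qed.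

Let x_dist i j : torus_dist (tnth x i) (tnth x j) = torus_dist (y i) (y j).
Proof. by rewrite torus_dist_offset. Qed.

Let y_inj i j : y i = y j -> i = j.
Proof.
move=> /offset_inj xij; apply/eqP; apply: contraT => ij.
have /andP[/'forall_forallP /(_ i j) /implyP /(_ ij) /eqP] := genx.
by case; apply: xij.
Qed.

(** Being covered, for an arbitrary point of the circle given by its offset. *)
Definition spanned (t : R) : Prop := exists i j : 'I_n,
  [/\ (i, j) \in nn_tree x, torus_dist (y i) t < torus_dist (y i) (y j)
    & torus_dist (y j) t < torus_dist (y j) (y i)].

Lemma spanned_covered v : spanned (y v) -> covered x (nn_tree x) v.
Proof.
move=> [i [j [ij iv jv]]]; apply/existsP; exists (i, j).
by rewrite ij /closer /= !x_dist iv jv.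
Qed.

Lemma parent_edge (k q : 'I_n) : nearest x k q ->
  (k, q) \in nn_tree x.
Proof.
move=> nkq; rewrite !inE /=; have /andP[qk _] := nkq; rewrite qk /=.
have /andP[_ tf] := genx.
rewrite nn_parent_eq ?nkq// => i j; exact: tie_free_nearest.
Qed.

(** The vertices of [C] are those that have cut the gap.  As long as the gap is
active, no vertex lies inside it ([inv_gap]), so that a new vertex inside is
nearest to one of the two ends; these are vertices of [C], or the root, whose
offset counts as 0 and as 1 ([inv_lov], [inv_hiv]).  Consequently, whatever has
left the gap is spanned by an edge, except for the root and the vertices of [C]
([inv_span]). *)
Record chain_inv (k : nat) (C : {set 'I_n}) (s : gap_state R) : Prop := {
  inv_lo0 : 0 <= lo s;
  inv_lohi : lo s < hi s;
  inv_hi1 : hi s <= 1;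
  inv_card : #|C| = (short s + long s)%N;
  inv_bound : (short s + long s <= K)%N;
  inv_long : (long s)%:R * eta <= 1 - (hi s - lo s);
  inv_lt : {in C, forall c : 'I_n, (c < k)%N};
  inv_gap : active K s -> forall j : 'I_n, (j < k)%N ->
    y j <= lo s \/ hi s <= y j;
  inv_lov : exists2 u : 'I_n, (u < k)%N /\ y u = lo s & (lo s = 0 \/ u \in C);
  inv_hiv : exists2 u : 'I_n, (u < k)%N &
    (hi s = 1 /\ y u = 0) \/ (hi s = y u /\ u \in C);
  inv_span : forall t, 0 <= t < 1 -> (t <= lo s \/ hi s <= t) ->
    [\/ t = 0, exists2 c, c \in C & t = y c | spanned t] }.

Lemma chain_inv_init : chain_inv 1 finset.set0 (Gap 0 1 0 0).
Proof.
split=> //=; rewrite ?cards0 ?mul0r ?subr0 ?subrr//.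
- by move=> c; rewrite inE.
- move=> _ j; rewrite ltnS leqn0 => /eqP j0; left.
  by rewrite (_ : j = root) ?y_root//; apply: val_inj.
- by exists root; [split|left].
- by exists root => //; left.
- by move=> t /andP[t0 t1] [tl|th]; [constructor 1|exfalso]; lra.
Qed.

(** If the new vertex [k] falls into an active gap, then it is joined to the
closer end [u], and every point strictly between [u] and [k] is closer to both
than they are to each other. *)
Lemma chain_inv_step (k : 'I_n) (C : {set 'I_n}) s : (0 < k)%N ->
  chain_inv k C s -> exists C', chain_inv k.+1 C' (gap_step K eta s (y k)).
Proof.
move=> k0 [lo0 lohi hi1 cardC NK longs ltC gap].
move=> [u [uk yu] uC] [u' u'k hu'] span.
have [nE | gE] := boolP (active K s && (lo s < y k < hi s)); last first.
  exists C; rewrite /gap_step (negbTE gE); split=> //.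
  - by move=> c /ltC /ltnW.
  - move=> act j; rewrite ltnS leq_eqVlt.
    move=> /orP[/eqP/val_inj ->|]; last exact: gap.
    move: gE; rewrite act /= negb_and -!leNgt.
    by case/orP; [left|right].
  - by exists u => //; split=> //; exact: ltnW.
  - by exists u' => //; exact: ltnW.
rewrite /gap_step nE; have /andP[act /andP[lk kh]] := nE.
have {}gap := gap act.
have NK' : (short s + long s < K)%N by case/andP: act.
have kE : k \notin C by apply/negP => /ltC; rewrite ltnn.
have parentE (v : 'I_n) : (v < k)%N ->
    (forall j : 'I_n, (j < k)%N ->
      torus_dist (y k) (y v) <= torus_dist (y k) (y j)) -> nearest x k v.
  move=> vk vmin; rewrite /nearest vk; apply/forallP => j; apply/implyP => jk.
  by rewrite !x_dist; exact: vmin.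
have outside (j : 'I_n) : (j < k)%N ->
    y k - lo s <= torus_dist (y k) (y j) \/
    hi s - y k <= torus_dist (y k) (y j).
  move=> jk; have /andP[yj0 yj1] := y01 j; rewrite /torus_dist.
  case: (gap j jk) => hj.
    rewrite ger0_norm; last by lra.
    by case: (leP (y k - y j) (1 - (y k - y j))) => _; [left|right]; lra.
  rewrite ler0_norm; last by lra.
  by case: (leP (- (y k - y j)) (1 - - (y k - y j))) => _; [right|left]; lra.
have newC l h cut : #|k |: C| = (short (shrink eta s l h cut) +
    long (shrink eta s l h cut))%N.
  by rewrite cardsU1 kE cardC count_shrink.
have newlt : {in k |: C, forall c : 'I_n, (c < k.+1)%N}.
  by move=> c; rewrite in_setU1 => /orP[/eqP ->//|/ltC /ltnW].
case: ifPn => [left_cut|/negbTE right_cut].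
(* The point k cuts off the lower end; the edge (k, u) spans ]lo, y k[. *)
- have du : torus_dist (y k) (y u) = y k - lo s.
    by rewrite torus_distC yu torus_dist_short//; lra.
  have /parent_edge edge : nearest x k u.
    by apply: parentE => // j jk; rewrite du; case: (outside j jk); lra.
  exists (k |: C); split; rewrite ?lo_shrink ?hi_shrink.
  + by lra.
  + by [].
  + by [].
  + exact: newC.
  + by rewrite count_shrink.
  + apply: le_trans (long_shrink _ _ _ _ _) _; first by lra.
    by lra.
  + exact: newlt.
  + move=> _ j; rewrite ltnS leq_eqVlt.
    move=> /orP[/eqP/val_inj ->|jk]; first by left.
    by case: (gap j jk) => ?; [left; lra|right].
  + by exists k; [split|right; rewrite setU11].
  + exists u'; first exact: ltnW.
    case: hu' => [?|[? u'C]]; first by left.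
    by right; split=> //; rewrite in_setU1 u'C orbT.
  + move=> t t01 ht; have [tlo|lot] := leP t (lo s).
      case: (span t t01 (or_introl tlo)) => [?|[c cC ?]|?];
        [constructor 1|constructor 2|constructor 3] => //.
      by exists c; rewrite // in_setU1 cC orbT.
    case: ht => [tk|ht]; last first.
      case: (span t t01 (or_intror ht)) => [?|[c cC ?]|?];
        [constructor 1|constructor 2|constructor 3] => //.
      by exists c; rewrite // in_setU1 cC orbT.
    have [->|tk'] := eqVneq t (y k).
      by constructor 2; exists k; rewrite ?setU11.
    have {tk'}tk : t < y k by rewrite lt_neqAle tk'.
    constructor 3; exists k, u; split=> //.
      rewrite du torus_distC torus_dist_short; lra.
    rewrite [ltRHS]torus_distC du yu torus_dist_short; lra.
(* The point k cuts off the upper end; for hi = 1 the vertex u' is the root,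
   whose offset is 0. *)
- have hk : hi s - y k <= y k - lo s by rewrite leNgt right_cut.
  have du : torus_dist (y k) (y u') = hi s - y k.
    case: hu' => [[h1 yu0]|[hy _]].
      rewrite yu0 /torus_dist subr0 ger0_norm; last by lra.
      by rewrite min_r; lra.
    by rewrite hy torus_dist_short//; lra.
  have /parent_edge edge : nearest x k u'.
    by apply: parentE => // j jk; rewrite du; case: (outside j jk); lra.
  exists (k |: C); split; rewrite ?lo_shrink ?hi_shrink.
  + by [].
  + by [].
  + by lra.
  + exact: newC.
  + by rewrite count_shrink.
  + apply: le_trans (long_shrink _ _ _ _ _) _; first by lra.
    by lra.
  + exact: newlt.
  + move=> _ j; rewrite ltnS leq_eqVlt.
    move=> /orP[/eqP/val_inj ->|jk]; first by right.
    by case: (gap j jk) => ?; [left|right; lra].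
  + exists u; first by split=> //; exact: ltnW.
    by case: uC => uC; [left|right; rewrite in_setU1 uC orbT].
  + by exists k => //; right; rewrite setU11.
  + move=> t t01 ht; have [hit|thi] := leP (hi s) t.
      case: (span t t01 (or_intror hit)) => [?|[c cC ?]|?];
        [constructor 1|constructor 2|constructor 3] => //.
      by exists c; rewrite // in_setU1 cC orbT.
    case: ht => [ht|tk].
      case: (span t t01 (or_introl ht)) => [?|[c cC ?]|?];
        [constructor 1|constructor 2|constructor 3] => //.
      by exists c; rewrite // in_setU1 cC orbT.
    have [->|tk'] := eqVneq t (y k).
      by constructor 2; exists k; rewrite ?setU11.
    have {tk'}tk : y k < t by rewrite lt_neqAle eq_sym tk'.
    constructor 3; exists k, u'; split=> //.
      rewrite du torus_dist_short; lra.
    rewrite [ltRHS]torus_distC du.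
    case: hu' => [[h1 yu0]|[hy _]].
      apply: le_lt_trans (torus_dist_le_compl _ _) _.
      by rewrite yu0 sub0r normrN ger0_norm; lra.
    by rewrite torus_distC -hy torus_dist_short; lra.
Qed.

Lemma chain_inv_at k : (0 < k)%N -> (k <= n)%N ->
  exists C, chain_inv k C (gap_chain K eta root_offset k).
Proof.
elim: k => // -[_ _ _|k IH _ kn].
  (* The root itself has offset 0 and does not cut the gap. *)
  exists finset.set0; rewrite /= /gap_step.
  have -> : root_offset 0 = 0 by rewrite (yE root) y_root.
  by rewrite /= ltxx andbF; exact: chain_inv_init.
have [//|C invC] := IH _ (ltnW kn).
have := @chain_inv_step (Ordinal kn) C _ _ invC.
by rewrite -yE => /(_ isT).
Qed.

(** When the later end of an edge arrived, the root was present and not strictly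
closer to it than the end that it chose. *)
Lemma root_uncovered : ~~ covered x (nn_tree x) root.
Proof.
apply/negP => /existsP[[a b] /andP[]].
rewrite !inE /= => /orP[/andP[ba /eqP pa]|/andP[ab /eqP pb]] /andP[cl1 cl2].
  have : nearest x a b.
    by rewrite -pa; apply: nn_parentP; apply: leq_ltn_trans ba.
  move=> /andP[_ /forallP /(_ root)]; rewrite (leq_ltn_trans (leq0n b) ba) /=.
  by rewrite leNgt -/(closer x a root b) cl1.
have : nearest x b a by rewrite -pb; apply: nn_parentP; apply: leq_ltn_trans ab.
move=> /andP[_ /forallP /(_ root)]; rewrite (leq_ltn_trans (leq0n a) ab) /=.
by rewrite leNgt -/(closer x b root a) cl2.
Qed.

(** Uncovered vertices outside the gap belong to the chain, which has at most
[K] vertices.  While the gap is active, this applies to all vertices and the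
chain has fewer than [K].  If the gap has length at most 1/3, then either
[lo >= 1/3] or [hi <= 2/3]: one of the thirds next to the root is outside the
gap, and it omits the vertex at that end of the gap. *)
Lemma root_candidate :
  let s := gap_chain K eta root_offset n in
  ~~ ((1 / 3%:R < hi s - lo s) && (short s + long s == K)%N) ->
  root \in candidates K x (nn_tree x).
Proof.
move=> s good; rewrite inE root_uncovered /=.
have [C [lo0 lohi hi1 cardC NK _ _ gap [u [_ yu] uC] [u' _ hu'] span]] :=
  chain_inv_at n0 (leqnn n).
rewrite -/s in lo0 lohi hi1 cardC NK gap yu uC hu' span.
have in_chain w : ~~ covered x (nn_tree x) w -> w != root ->
    y w <= lo s \/ hi s <= y w -> w \in C.
  move=> ncw wr /(span _ (y01 w)) [y0|[c cC /y_inj ->]|/spanned_covered cw]//.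
    by case/eqP: wr; apply: y_inj; rewrite y0 y_root.
  by rewrite cw in ncw.
have behindE w : w != root -> offset (tnth x w) (tnth x root) = 1 - y w.
  move=> wr; rewrite offset_swap//; apply: contra wr => /eqP xw.
  by apply/eqP; apply: y_inj; rewrite /y xw.
have [act|] := boolP (active K s).
  apply/orP; left; apply: leq_ltn_trans (subset_leq_card _) _; last first.
    by have /andP[_] := act; rewrite -cardC; exact.
  apply/fintype.subsetP => w; rewrite inE => /and3P[ncw wr _].
  by apply: in_chain => //; apply: gap.
rewrite /active => nact.
have [g13|g13] := ltP (1 / 3%:R) (hi s - lo s).
  move: nact good; rewrite g13 /= -leqNgt => KN.
  by rewrite eqn_leq KN NK.
have [lo13|lo13] := leP (1 / 3%:R) (lo s).
  have uC' : u \in C by case: uC => // lo_eq0; exfalso; lra.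
  apply/orP; left; apply: leq_trans NK.
  rewrite -cardC (cardsD1 u C) uC' add1n ltnS.
  apply: subset_leq_card; apply/fintype.subsetP => w.
  rewrite inE => /and3P[ncw wr]; rewrite /ahead -/(y w) => yw.
  rewrite in_setD1 in_chain ?andbT//; last by left; lra.
  by apply/eqP => wu; move: yw; rewrite wu yu; lra.
have hu : hi s = y u' /\ u' \in C by case: hu' => // -[? _]; exfalso; lra.
case: hu => hy u'C.
apply/orP; right; apply: leq_trans NK.
rewrite -cardC (cardsD1 u' C) u'C add1n ltnS.
apply: subset_leq_card; apply/fintype.subsetP => w.
rewrite inE => /and3P[ncw wr]; rewrite /ahead behindE// => yw.
rewrite in_setD1 in_chain ?andbT//; last by right; lra.
by apply/eqP => wu; move: yw; rewrite wu; lra.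
Qed.

End chain_structure.

(** * The weight of a gap *)

Local Open Scope classical_set_scope.

Section chain_facts.
Context (R : realType) (K : nat) (eta : R).

Lemma gap_chain_ext (y z : nat -> R) k :
  (forall i, (i < k)%N -> y i = z i) ->
  gap_chain K eta y k = gap_chain K eta z k.
Proof.
elim: k => //= k IH yz; rewrite yz// IH// => i ik.
by apply: yz; exact: ltnW.
Qed.

Lemma gap_chain_bounds (y : nat -> R) k (s := gap_chain K eta y k) :
  [/\ 0 <= lo s, lo s < hi s & hi s <= 1].
Proof.
rewrite {}/s; elim: k => [|k [lo0 lohi hi1]] /=; first by rewrite ltr01.
rewrite /gap_step; case: ifP => // /andP[_ /andP[lk kh]].
by case: ifP => _; rewrite lo_shrink hi_shrink; split => //; lra.
Qed.

Section measurability.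
Context d (T : measurableType d) (y : nat -> T -> R).
Hypothesis my : forall i, measurable_fun setT (y i).

Let s k w := gap_chain K eta (y ^~ w) k.

(** Each component is a case distinction on measurable comparisons. *)
Lemma measurable_gap_chain k :
  [/\ measurable_fun setT (fun w => lo (s k w)),
      measurable_fun setT (fun w => hi (s k w)),
      measurable_fun setT (fun w => short (s k w)) &
      measurable_fun setT (fun w => long (s k w))].
Proof.
elim: k => [|k [ml mh ms mg]]; first by split; exact: measurable_cst.
pose go w := active K (s k w) && (lo (s k w) < y k w < hi (s k w)).
pose lf w := y k w - lo (s k w) < hi (s k w) - y k w.
pose dl w := y k w - lo (s k w) <= eta.
pose dh w := hi (s k w) - y k w <= eta.
have mgo : measurable_fun setT go.
  apply: measurable_and; apply: measurable_and.
  - by apply: measurable_fun_ltr => //; exact: measurable_funB.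
  - by apply: measurable_fun_ltn => //; exact: measurable_fun_addn.
  - exact: measurable_fun_ltr.
  - exact: measurable_fun_ltr.
have mlf : measurable_fun setT lf.
  by apply: measurable_fun_ltr; exact: measurable_funB.
have mdl : measurable_fun setT dl.
  by apply: measurable_fun_ler => //; exact: measurable_funB.
have mdh : measurable_fun setT dh.
  by apply: measurable_fun_ler => //; exact: measurable_funB.
have mS (f : T -> nat) : measurable_fun setT f ->
    measurable_fun setT (fun w => (f w).+1).
  move=> mf; rewrite (_ : (fun w => _) = (fun w => f w + 1)%N).
    by apply: measurable_fun_addn => //; exact: measurable_cst.
  by apply/funext => w; rewrite addn1.
split.
- rewrite (_ : (fun w => _) = (fun w => if go w then
      if lf w then y k w else lo (s k w) else lo (s k w))).
    by do 2 apply: measurable_fun_ifT => //.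
  apply/funext => w; rewrite /s /= /gap_step -/(s k w) -/(go w) -/(lf w).
  by case: ifP => // _; case: ifP => _; rewrite lo_shrink.
- rewrite (_ : (fun w => _) = (fun w => if go w then
      if lf w then hi (s k w) else y k w else hi (s k w))).
    by do 2 apply: measurable_fun_ifT => //.
  apply/funext => w; rewrite /s /= /gap_step -/(s k w) -/(go w) -/(lf w).
  by case: ifP => // _; case: ifP => _; rewrite hi_shrink.
- rewrite (_ : (fun w => _) = (fun w => if go w then
      if lf w then if dl w then (short (s k w)).+1 else short (s k w)
      else if dh w then (short (s k w)).+1 else short (s k w)
      else short (s k w))).
    by do 3 apply: measurable_fun_ifT => //; exact: mS.
  apply/funext => w; rewrite /s /= /gap_step -/(s k w) -/(go w) -/(lf w).
  case: ifP => // _; case: ifP => _; rewrite /shrink ?/dl ?/dh;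
    by case: ifP.
- rewrite (_ : (fun w => _) = (fun w => if go w then
      if lf w then if dl w then long (s k w) else (long (s k w)).+1
      else if dh w then long (s k w) else (long (s k w)).+1
      else long (s k w))).
    by do 3 apply: measurable_fun_ifT => //; exact: mS.
  apply/funext => w; rewrite /s /= /gap_step -/(s k w) -/(go w) -/(lf w).
  case: ifP => // _; case: ifP => _; rewrite /shrink ?/dl ?/dh;
    by case: ifP.
Qed.

End measurability.

End chain_facts.

Section weight.
Context (R : realType) (theta : R).

(** For [theta] of order [1 / eta], the expected increase due to short cuts is
compensated by the halving that a long cut brings. *)
Definition weight (s : gap_state R) : R :=
  theta ^+ short s * (1 / 2%:R) ^+ long s.

Hypothesis theta0 : 0 <= theta.

Lemma weight_ge0 s : 0 <= weight s.
Proof. by rewrite mulr_ge0 ?exprn_ge0 ?divr_ge0. Qed.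

Lemma weight_shrink eta s l h cut :
  weight (shrink eta s l h cut) =
  weight s * (if cut <= eta then theta else 1 / 2%:R).
Proof. by rewrite /weight /shrink; case: ifP => _ /=; rewrite exprS; ring. Qed.

Lemma measurable_weight_chain K eta d (T : measurableType d)
    (y : nat -> T -> R) k :
  (forall i, measurable_fun setT (y i)) ->
  measurable_fun setT (fun w => weight (gap_chain K eta (y ^~ w) k)).
Proof.
move=> my; have [_ _ ms mg] := measurable_gap_chain K eta my k.
apply: measurable_funM.
  exact: (@measurableT_comp _ _ _ _ _ _ (fun m : nat => theta ^+ m)).
exact: (@measurableT_comp _ _ _ _ _ _ (fun m : nat => (1 / 2%:R : R) ^+ m)).
Qed.

End weight.

Section one_step.
Context (R : realType) (K : nat) (eta theta : R).
Hypotheses (eta0 : 0 <= eta) (theta0 : 0 <= theta).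
Context (s : gap_state R) (x0 : R).

(** The gap is an arc longer than 1/3.  In the coordinates [0, 1[ it may be
broken at 0, but then one of the two parts is longer than 1/6. *)
Lemma gap_contains_interval : 0 <= x0 < 1 -> active K s -> 0 <= lo s ->
  hi s <= 1 -> exists a b : R, [/\ 0 <= a, a <= b, b <= 1, 1 / 6%:R <= b - a &
   forall x, a < x < b -> lo s < offset x0 x < hi s].
Proof.
move=> /andP[x00 x0l] /andP[g13 _] lo0 hi1.
have [h|h] := leP (x0 + hi s) 1.
  exists (x0 + lo s), (x0 + hi s); split; try lra.
  move=> x /andP[xa xb]; rewrite /offset ifT; last by lra.
  by apply/andP; split; lra.
have [l|l] := leP 1 (x0 + lo s).
  exists (x0 + lo s - 1), (x0 + hi s - 1); split; try lra.
  move=> x /andP[xa xb]; rewrite /offset ifF; last first.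
    by apply/negbTE; rewrite -ltNge; lra.
  by apply/andP; split; lra.
have [m|m] := leP (1 / 6%:R) (1 - (x0 + lo s)).
  exists (x0 + lo s), 1; split; try lra.
  move=> x /andP[xa xb]; rewrite /offset ifT; last by lra.
  by apply/andP; split; lra.
exists 0, (x0 + hi s - 1); split; try lra.
move=> x /andP[xa xb]; rewrite /offset ifF; last first.
  by apply/negbTE; rewrite -ltNge; lra.
by apply/andP; split; lra.
Qed.

(** A short cut puts the new point within [eta] of an end of the gap.  Each end
contributes two intervals, since its position [x0 + lo s] or [x0 + hi s] may
have to be reduced by 1. *)
Definition near_ends : seq R :=
  [:: x0 + lo s; x0 + lo s - 1; x0 + hi s - eta; x0 + hi s - eta - 1].

(** A point outside the gap leaves the weight unchanged, which is the factor
[1 / 2 + 1 / 2]; a long cut has the factor [1 / 2], and a short cut the factor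
[theta]. *)
Lemma weight_step_le (a b : R) : active K s ->
  (forall x, a < x < b -> lo s < offset x0 x < hi s) ->
  forall x, weight theta (gap_step K eta s (offset x0 x)) <=
    weight theta s * (1 / 2%:R + 1 / 2%:R * \1_(~` `]a, b[) x +
      \sum_(p <- near_ends) theta * \1_`[p, p + eta] x).
Proof.
move=> act abgap x; set y := offset x0 x.
have ws := weight_ge0 theta0 s.
have sum0 : 0 <= \sum_(p <- near_ends) theta * \1_`[p, p + eta] x :> R.
  by apply: sumr_ge0 => p _; rewrite mulr_ge0.
have [nin|nin] := boolP (lo s < y < hi s); last first.
  rewrite /gap_step (negbTE nin) andbF ler_peMr//.
  have -> : \1_(~` `]a, b[) x = 1 :> R.
    rewrite indicE mem_set//= in_itv /= => /abgap; exact/negP.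
  by lra.
have Ic0 : 0 <= 1 / 2%:R * \1_(~` `]a, b[) x :> R by rewrite mulr_ge0 ?divr_ge0.
have step_le cut : (cut <= eta ->
      theta <= \sum_(p <- near_ends) theta * \1_`[p, p + eta] x) ->
    weight theta s * (if cut <= eta then theta else 1 / 2%:R) <=
    weight theta s * (1 / 2%:R + 1 / 2%:R * \1_(~` `]a, b[) x +
      \sum_(p <- near_ends) theta * \1_`[p, p + eta] x).
  by move=> le_theta; rewrite ler_wpM2l//; case: ifP => [/le_theta|_]; lra.
have mem_le p : p \in near_ends -> p <= x <= p + eta ->
    theta <= \sum_(p <- near_ends) theta * \1_`[p, p + eta] x.
  move=> pin px; rewrite (big_rem p)//=.
  have -> : \1_`[p, p + eta] x = 1 :> R by rewrite indicE mem_set//= in_itv.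
  by rewrite mulr1 lerDl sumr_ge0// => q _; rewrite mulr_ge0.
move: nin; rewrite /gap_step act /= => nin; rewrite nin.
have /andP[ly yh] := nin.
have yx : y = x - x0 \/ y = x - x0 + 1.
  by rewrite /y /offset; case: ifP; [left|right].
case: ifP => _; rewrite weight_shrink; apply: step_le => cut.
  case: yx => yx.
    by apply: (mem_le (x0 + lo s)); rewrite ?inE ?eqxx//;
      apply/andP; split; lra.
  by apply: (mem_le (x0 + lo s - 1)); rewrite ?inE ?eqxx ?orbT//;
    apply/andP; split; lra.
case: yx => yx.
  by apply: (mem_le (x0 + hi s - eta)); rewrite ?inE ?eqxx ?orbT//;
    apply/andP; split; lra.
by apply: (mem_le (x0 + hi s - eta - 1)); rewrite ?inE ?eqxx ?orbT//;
  apply/andP; split; lra.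
Qed.

End one_step.

Section supermartingale.
Context (d : measure_display) (T : measurableType d) (R : realType).
Context (P : probability T R) (X : nat -> {RV P >-> R}).
Hypothesis unifX : uniform_positions X.
Context (K : nat) (eta theta : R).
Hypotheses (eta0 : 0 <= eta) (theta0 : 0 <= theta).
Hypothesis small_steps : theta * eta * 48%:R <= 1.

Lemma integral_law_cst n (c : R) :
  (\int[distribution P (X n)]_x c%:E = c%:E)%E.
Proof.
rewrite integral_cst// [X in (_ * X)%E](_ : _ = 1%E) ?mule1//.
exact: (probability_setT (distribution P (X n))).
Qed.

Lemma integral_scaled_indic n (c : R) (A : set R) : 0 <= c -> measurable A ->
  (\int[distribution P (X n)]_x (c * \1_A x)%:E
   = c%:E * distribution P (X n) A)%E.
Proof.
move=> c0 mA; under eq_integral do rewrite EFinM.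
rewrite ge0_integralZl_EFin//.
- by rewrite integral_indic// setIT.
- by apply/measurable_EFinP; exact: measurable_indic.
Qed.

(** Integrating [weight_step_le], the factor is at most
[1 / 2 + 1 / 2 * (1 - 1 / 6) + 4 * theta * eta], and [small_steps] says exactly
that this is at most 1. *)
Lemma weight_step_integral n (y : nat -> R) (x0 : R)
    (s := gap_chain K eta y n) :
  0 <= x0 < 1 ->
  (\int[distribution P (X n)]_x
     (weight theta (gap_step K eta s (offset x0 x)))%:E
   <= (weight theta s)%:E)%E.
Proof.
move=> x01; have [lo0 lohi hi1] := gap_chain_bounds K eta y n.
rewrite -/s in lo0 lohi hi1.
have ws := weight_ge0 theta0 s.
have [act|nact] := boolP (active K s); last first.
  under eq_integral do rewrite /gap_step (negbTE nact) /=.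
  by rewrite integral_law_cst.
have [a [b [a0 ab b1 ab6 abgap]]] := gap_contains_interval x01 act lo0 hi1.
pose ends := near_ends eta s x0.
pose B (x : R) : R := 1 / 2%:R * \1_(~` `]a, b[) x.
pose N (p x : R) : R := theta * \1_`[p, p + eta] x.
have mo : measurable_fun setT (fun x : R => offset x0 x).
  by apply: measurable_offset.
have mB : measurable_fun setT (EFin \o B).
  apply/measurable_EFinP; apply: measurable_funM => //.
  by apply: measurable_indic; exact: measurableC.
have mN p : measurable_fun setT (EFin \o N p).
  by apply/measurable_EFinP; apply: measurable_funM.
have B0 x : 0 <= B x by rewrite mulr_ge0 ?divr_ge0.
have N0 p x : 0 <= N p x by rewrite mulr_ge0.
pose g x := ((1 / 2%:R)%:E + (B x)%:E + \sum_(p <- ends) (N p x)%:E)%E.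
have mA : measurable_fun setT (fun x => ((1 / 2%:R)%:E + (B x)%:E)%E : \bar R).
  by apply: emeasurable_funD => //.
have mS : measurable_fun setT
    (fun x => (\sum_(p <- ends) (N p x)%:E)%E : \bar R).
  exact: emeasurable_sum.
have mg : measurable_fun setT g by apply: emeasurable_funD.
have g0 x : (0 <= g x)%E.
  by rewrite !adde_ge0 ?lee_fin ?divr_ge0// sume_ge0// => p _; rewrite lee_fin.
apply: (@le_trans _ _
    (\int[distribution P (X n)]_x ((weight theta s)%:E * g x))%E).
  apply: ge0_le_integral => //.
  - by move=> x _; rewrite lee_fin weight_ge0.
  - apply/measurable_EFinP.
    pose z i x := if (i < n)%N then y i else offset x0 x.
    rewrite (_ : (fun x => _) =
        (fun x => weight theta (gap_chain K eta (z ^~ x) n.+1))).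
      apply: measurable_weight_chain => i; rewrite /z.
      by case: (i < n)%N; [exact: measurable_cst|exact: mo].
    apply/funext => x /=; rewrite (_ : gap_chain K eta (z ^~ x) n = s).
      by rewrite /z ltnn.
    by apply: gap_chain_ext => i ni; rewrite /z ni.
  - exact: measurable_funeM.
  - move=> x _; rewrite /g sumEFin -!EFinD -EFinM lee_fin.
    exact: weight_step_le.
rewrite ge0_integralZl_EFin//.
rewrite -[leRHS]mule1; apply: lee_wpmul2l; first by rewrite lee_fin.
rewrite /g ge0_integralD//; last 2 first.
- by move=> x _; rewrite adde_ge0 ?lee_fin ?divr_ge0.
- by move=> x _; rewrite sume_ge0// => p _; rewrite lee_fin.
rewrite ge0_integralD//; last by move=> x _; rewrite lee_fin.
rewrite ge0_integral_sum//; last by move=> p x _; rewrite lee_fin.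
rewrite integral_law_cst.
rewrite /B integral_scaled_indic ?divr_ge0//; last exact: measurableC.
rewrite [distribution P (X n) (~` _)](_ : _ = (1 - (b - a))%:E); last first.
  rewrite EFinB -(law_itv unifX n false true a0 ab b1).
  exact: (probability_setC (distribution P (X n))).
have sumN : (\sum_(p <- ends) \int[distribution P (X n)]_x (N p x)%:E <=
    (4%:R * (theta * eta))%:E)%E.
  apply: (@le_trans _ _ (\sum_(p <- ends) (theta * eta)%:E)%E).
    apply: lee_sum => p _; rewrite integral_scaled_indic// EFinM.
    apply: lee_wpmul2l; first by rewrite lee_fin.
    have := @law_le_itv _ _ _ _ _ unifX n p (p + eta).
    by rewrite lerDl addrAC subrr add0r; exact.
  by rewrite sumEFin lee_fin /ends /near_ends !big_cons big_nil; lra.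
apply: le_trans (leeD (lexx _) sumN) _.
rewrite -EFinM -!EFinD lee_fin.
move: small_steps ab6 => h1 h2; lra.
Qed.

Definition start_offset (w : T) (i : nat) : R := offset (X 0%N w) (X i w).

(** The weight is a supermartingale: the last point is integrated first, with
the earlier ones fixed. *)
Lemma expected_weight n :
  (\int[P]_w (weight theta (gap_chain K eta (start_offset w) n))%:E <= 1)%E.
Proof.
have [X01 _ _] := unifX.
elim: n => [|n IH].
  under eq_integral do rewrite /weight /= !expr0 mulr1.
  by rewrite integral_cst// mul1e; exact: probability_le1.
apply: le_trans IH; have [->|n0] := posnP n.
  rewrite le_eqVlt; apply/orP; left; apply/eqP; apply: eq_integral => w _.
  by rewrite /= /gap_step /start_offset offsetxx /= ltxx andbF.
pose z i (u : n.-tuple R * R) : R := if (i < n)%N then nth 0 u.1 i else u.2.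
have mz i : measurable_fun setT (z i).
  rewrite /z; case: (i < n)%N; last exact: measurable_snd.
  exact: (measurableT_comp (@measurable_nth R n i) measurable_fst).
pose f u : \bar R := (weight theta
  (gap_chain K eta (fun i => offset (z 0%N u) (z i u)) n.+1))%:E.
have mf : measurable_fun setT f.
  apply/measurable_EFinP.
  apply: (@measurable_weight_chain R theta K eta _ _
    (fun i u => offset (z 0%N u) (z i u))) => i.
  exact: measurable_offset.
have f0 u : (0 <= f u)%E by rewrite lee_fin weight_ge0.
have zE w i : (i < n)%N -> forall x, z i (positions X n w, x) = X i w.
  by move=> ni x; rewrite /z ni nth_positions.
have := integral_positions_next unifX mf f0.
rewrite (eq_integral (fun w => (weight theta
  (gap_chain K eta (start_offset w) n.+1))%:E)); last first.
  move=> w _; rewrite /f; congr (weight theta _)%:E.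
  apply: gap_chain_ext => i ni.
  rewrite /start_offset zE//; congr offset.
  move: ni; rewrite ltnS leq_eqVlt => /orP[/eqP ->|ni]; last by rewrite zE.
  by rewrite /z ltnn.
move=> ->.
apply: ge0_le_integral => //.
- by move=> w _; apply: integral_ge0.
- have := measurable_fun_fubini_tonelli_F
    (m2 := distribution P (X n)) f mf f0.
  move=> mF; exact: (measurableT_comp mF (@measurable_positions _ _ _ P X n)).
- apply/measurable_EFinP; apply: measurable_weight_chain => i.
  exact: measurable_offset.
- move=> w _.
  have := @weight_step_integral n (start_offset w) (X 0%N w) (X01 0%N w).
  apply: le_trans; rewrite le_eqVlt; apply/orP; left; apply/eqP.
  apply: eq_integral => x _; rewrite /f /=.
  rewrite zE// (_ : z n _ = x); last by rewrite /z ltnn.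
  rewrite (@gap_chain_ext _ K eta (start_offset w)
    (fun i => offset (X 0%N w) (z i (positions X n w, x))))// => i ni.
  by rewrite zE.
Qed.

End supermartingale.

(** * The root is a candidate with high probability *)

Section root_found.
Context (R : realType).

(** As [K >= 128 ^ 2], the number [K / 128] is at least the square root of [K];
as [a >= K / 2], the right-hand side is at least
[(K / 128) ^ a >= K ^ (K / 4) >= 1 / eps]. *)
Lemma heavy_weight (K a b : nat) (eps : R) :
  0 < eps -> (128 ^ 2 < K)%N -> 4%:R * ln (1 / eps) <= nlogn R K ->
  (a + b)%N = K -> (b <= a)%N ->
  1 / eps <= (K%:R / 64%:R) ^+ a * (1 / 2%:R) ^+ b.
Proof.
move=> eps0 K128 LK abK ba.
have K0 : 0 < K%:R :> R by rewrite ltr0n; apply: leq_trans K128.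
have sqK : K%:R <= (K%:R / 128%:R) ^+ 2 :> R.
  rewrite expr_div_n ler_pdivlMr ?exprn_gt0//.
  by rewrite [K%:R ^+ 2]expr2 ler_wpM2l// -natrX ler_nat ltnW.
have r0 : 0 < K%:R / 128%:R :> R by rewrite divr_gt0.
have lnK : ln K%:R <= 2 * ln (K%:R / 128%:R) :> R.
  by rewrite mulr_natl -lnXn// ler_ln ?posrE ?exprn_gt0.
have half : (1 / 2%:R) ^+ a <= (1 / 2%:R) ^+ b :> R.
  by apply: ler_wiXn2l => //; rewrite ?divr_ge0//; lra.
apply: (@le_trans _ _ ((K%:R / 128%:R) ^+ a)); last first.
  rewrite (_ : K%:R / 128%:R = (K%:R / 64%:R) * (1 / 2%:R)); last by field.
  by rewrite exprMn ler_wpM2l ?exprn_ge0 ?divr_ge0.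
rewrite -ler_ln ?posrE ?exprn_gt0 ?divr_gt0// lnXn// -[ln _ *+ a]mulr_natl.
have aK : K%:R <= 2 * a%:R :> R by rewrite -natrM ler_nat; lia.
have l0 : 0 <= ln (K%:R / 128%:R) :> R by have := ln_nat_ge0 R K; lra.
have : K%:R * ln K%:R <= K%:R * (2 * ln (K%:R / 128%:R)) :> R.
  by rewrite ler_wpM2l// ltW.
have : K%:R * ln (K%:R / 128%:R) <= 2 * a%:R * ln (K%:R / 128%:R) :> R.
  by rewrite ler_wpM2r.
by move: LK; rewrite /nlogn; lra.
Qed.

(** The set has at most [6 K] elements, where [nlogn K.-1 < 4 t].  Passing from
[K.-1] to [K] costs a factor 3, and from [K] to [6 K] a factor 12. *)
Lemma candidates_size (K n : nat) (x : n.-tuple R) E (t : R) :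
  (forall v, 0 <= tnth x v < 1) -> K = threshold (4%:R * t) -> (8 < K)%N ->
  size_log_size R (candidates K x E) <= 144%:R * t.
Proof.
move=> x01 KE K8; rewrite /size_log_size -/(nlogn R _).
apply: le_trans (nlogn_le R (card_candidates K E x01)) _.
have KS : K = K.-1.+1 by lia.
have small : nlogn R K.-1 < 4%:R * t by rewrite -ltn_threshold -KE; lia.
have grow : nlogn R K <= 3 * nlogn R K.-1.
  by rewrite [in leLHS]KS; apply: nlognS; lia.
have K0 : 0 < K%:R :> R by rewrite ltr0n; lia.
have l6 : ln (6 * K)%:R <= 2 * ln K%:R :> R.
  rewrite mulr_natl -lnXn// -natrX; apply: ln_nat_le.
  by rewrite expnS expn1 leq_mul2r; lia.
have : nlogn R (6 * K) <= 12%:R * nlogn R K.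
  rewrite /nlogn (_ : 12%:R * _ = (6 * K)%:R * (2 * ln K%:R)).
    by rewrite ler_wpM2l.
  by rewrite natrM; ring.
lra.
Qed.

Context (d : measure_display) (T : measurableType d).
Context (P : probability T R) (X : nat -> {RV P >-> R}).
Hypothesis unifX : uniform_positions X.

(** Markov's inequality. *)
Lemma heavy_probability (K n : nat) (eta theta M : R) :
  0 <= eta -> 0 <= theta -> theta * eta * 48%:R <= 1 -> 0 < M ->
  (P [set w | (M <= weight theta (gap_chain K eta (start_offset X w) n))%R]
   <= M^-1%:E)%E.
Proof.
move=> eta0 theta0 small M0.
pose W w := weight theta (gap_chain K eta (start_offset X w) n).
have mW : measurable_fun setT W.
  apply: measurable_weight_chain => i; exact: measurable_offset.
set A := [set w | _].
have mA : measurable A by exact: measurable_ler_set.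
have MA : (M%:E * P A <= 1)%E.
  apply: le_trans (expected_weight unifX K eta0 theta0 small n).
  rewrite -[in leLHS](setIT A) -integral_indic//.
  rewrite -ge0_integralZl_EFin//; last 2 first.
  - by apply/measurable_EFinP; exact: measurable_indic.
  - exact: ltW.
  apply: ge0_le_integral => //.
  - by move=> w _; rewrite -EFinM lee_fin mulr_ge0// ltW.
  - by apply: measurable_funeM; apply/measurable_EFinP; exact: measurable_indic.
  - exact/measurable_EFinP.
  - move=> w _; rewrite -EFinM lee_fin indicE.
    have [wA|wA] := boolP (w \in A); last by rewrite mulr0 weight_ge0.
    by rewrite mulr1; move: wA; rewrite inE.
move: MA; have [p ->] : exists p, P A = p%:E.
  by exists (fine (P A)); rewrite fineK// fin_num_measure.
rewrite -EFinM !lee_fin => Mp.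
by rewrite -[leRHS]mul1r ler_pdivlMr// mulrC.
Qed.

(** The root can be missed only if [K] cuts have left a gap longer than 1/3.
The long ones among them have removed more than [4 / (3 K)] each and less than
2/3 in total, hence are at most half of the [K] cuts, and the weight is at least
[1 / eps]. *)
Lemma candidates_find_root (eps : R) (K := threshold (4%:R * ln (1 / eps))) :
  0 < eps -> (128 ^ 2 < K)%N -> finds_root X eps (candidates K).
Proof.
move=> eps0 K128; have [X01 _ _] := unifX.
have LK : 4%:R * ln (1 / eps) <= nlogn R K by rewrite -threshold_leq.
have K0 : 0 < K%:R :> R by rewrite ltr0n; apply: leq_trans K128.
(* K / 2 cuts longer than eta would remove 2 / 3 of the circle; theta is the
   largest value with theta * eta * 48 <= 1. *)
pose eta : R := 4%:R / (3%:R * K%:R).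
pose theta : R := K%:R / 64%:R.
have eta0 : 0 <= eta by rewrite divr_ge0// mulr_ge0// ltW.
have theta0 : 0 <= theta by rewrite divr_ge0// ltW.
have small : theta * eta * 48%:R <= 1.
  rewrite (_ : theta * eta * 48%:R = 1)// /theta /eta; field.
  by rewrite gt_eqF.
apply: (@limn_einf_ge R _ 1) => n n0.
set F := [set w | contains_root _].
pose heavy := [set w | 1 / eps <=
  weight theta (gap_chain K eta (start_offset X w) n)].
pose G := positions X n @^-1` [set t | generic t].
have mF : measurable F.
  exact: (measurable_positions_preimage X
    (@measurable_contains_root R n _ n0 (measurable_candidates K))).
have mG : measurable G.
  exact: (measurable_positions_preimage X (@measurable_generic R n)).
have mheavy : measurable heavy.
  apply: measurable_ler_set => //.
  by apply: measurable_weight_chain => i; exact: measurable_offset.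
have sub : G `\` heavy `<=` F.
  move=> w [/= gw light]; rewrite /F /= (contains_rootE n0).
  have x01 v : 0 <= tnth (positions X n w) v < 1 by rewrite tnth_mktuple.
  have chainE : gap_chain K eta (root_offset (positions X n w)) n =
      gap_chain K eta (start_offset X w) n.
    by apply: gap_chain_ext => i ni; rewrite /root_offset !nth_positions.
  have := @root_candidate R K eta n _ n0 x01 gw.
  rewrite chainE; apply; apply/negP => /andP[g13 /eqP sK]; apply: light.
  rewrite /heavy /=.
  have [C invC] := @chain_inv_at R K eta n _ n0 x01 gw n n0 (leqnn n).
  have := inv_long invC; rewrite chainE.
  move: g13 sK; set s := gap_chain _ _ _ _ => g13 sK longs.
  apply: (heavy_weight eps0 K128 LK sK).
  have : (2 * long s)%:R <= K%:R :> R.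
    have : (long s)%:R * eta <= 2%:R / 3%:R by lra.
    rewrite /eta mulrA ler_pdivrMr ?mulr_gt0// natrM; lra.
  by rewrite ler_nat; lia.
have PG : P G = 1%E := positions_generic unifX n.
have Ph : (P heavy <= eps%:E)%E.
  have := @heavy_probability K n eta theta (1 / eps) eta0 theta0 small.
  rewrite (_ : (1 / eps)^-1 = eps) ?div1r ?invrK//.
  by rewrite -div1r divr_gt0//; exact.
have PFh : (1 <= P F + P heavy)%E.
  rewrite -PG; apply: (@le_trans _ _ (P (F `|` heavy))).
    apply: le_measure; rewrite ?inE//; first exact: measurableU.
    move=> w Gw; have [hw|hw] := pselect (heavy w); first by right.
    by left; apply: sub.
  exact: measureU2.
move: PFh Ph; have [p ->] : exists p, P F = p%:E.
  by exists (fine (P F)); rewrite fineK// fin_num_measure.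
have [q ->] : exists q, P heavy = q%:E.
  by exists (fine (P heavy)); rewrite fineK// fin_num_measure.
by rewrite -EFinD !lee_fin; lra.
Qed.

End root_found.

(** * Running while programs *)

Local Close Scope classical_set_scope.

Section runs.
Context (R : realType).
Implicit Types (m : memory R) (c : cmd) (Q : memory R -> Prop).

(** A total correctness triple with a time bound. *)
Definition runs c m (t : nat) Q : Prop :=
  exists t' m', [/\ exec c m t' m', (t' <= t)%N & Q m'].

Lemma runs_weaken c m t t' Q Q' : (t <= t')%N -> (forall m', Q m' -> Q' m') ->
  runs c m t Q -> runs c m t' Q'.
Proof.
move=> tt' QQ' [s [m' [ex st Qm]]]; exists s, m'.
by split=> //; [exact: leq_trans tt'|exact: QQ'].
Qed.

Lemma runs_skip m t Q : Q m -> runs Skip m t Q.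
Proof. by move=> Qm; exists 0%N, m; split=> //; exact: ExecSkip. Qed.

Definition set_cell m (a i v : nat) : memory R :=
  Memory (upd (nmem m) a i v) (rmem m).

Lemma runs_nwrite a i e m Q :
  Q (set_cell m a (neval m i) (neval m e)) ->
  runs (NWrite a i e) m (ncost i + ncost e).+1 Q.
Proof.
by move=> Qm; eexists; eexists; split; [exact: ExecNWrite| |exact: Qm].
Qed.

Lemma runs_seq c1 c2 m t1 t2 Q1 Q : runs c1 m t1 Q1 ->
  (forall m', Q1 m' -> runs c2 m' t2 Q) -> runs (Seq c1 c2) m (t1 + t2) Q.
Proof.
move=> [s1 [m1 [ex1 st1 /[swap] h2 /h2 [s2 [m2 [ex2 st2 Qm]]]]]].
exists (s1 + s2)%N, m2; split=> //; last exact: leq_add.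
exact: ExecSeq ex1 ex2.
Qed.

Lemma runs_if b c1 c2 m t Q :
  (beval m b -> runs c1 m t Q) -> (~~ beval m b -> runs c2 m t Q) ->
  runs (If b c1 c2) m (bcost b + t) Q.
Proof.
move=> h1 h2; have [bm|bm] := boolP (beval m b).
  have [s [m' [ex st Qm]]] := h1 bm; exists (bcost b + s)%N, m'.
  by split=> //; [exact: ExecIfTrue|rewrite leq_add2l].
have [s [m' [ex st Qm]]] := h2 bm; exists (bcost b + s)%N, m'.
by split=> //; [exact: ExecIfFalse|rewrite leq_add2l].
Qed.

Definition cell (k : nat) : nexp := NRead k (NConst 0).

Definition nlt (e1 e2 : nexp) : bexp := BNot (BNLe e2 e1).

Definition for_loop (k : nat) (body : cmd) : cmd :=
  Seq (NWrite k (NConst 0) (NConst 0))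
    (While (nlt (cell k) (cell 0))
      (Seq body (NWrite k (NConst 0) (NAdd (cell k) (NConst 1))))).

(** Initializing the counter costs 3, each evaluation of the test 6 and each
increment 6.  The invariant may not depend on the counter, which is known to
hold [i] at the beginning of the round [i]. *)
Lemma runs_for k body n (Inv : nat -> memory R -> Prop) (T : nat -> nat) m :
  (forall i m', Inv i m' -> nmem m' 0 0 = n) ->
  (forall i m' v, Inv i m' -> Inv i (set_cell m' k 0 v)) ->
  (forall i m', (i < n)%N -> Inv i m' -> nmem m' k 0 = i ->
     runs body m' (T i) (fun m'' => Inv i.+1 m'' /\ nmem m'' k 0 = i)) ->
  Inv 0%N m ->
  runs (for_loop k body) m (9 + \sum_(i < n) (T i + 12)) (Inv n).
Proof.
move=> Invn Invk step Inv0.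
have loop j i m' : (i + j = n)%N -> Inv i m' -> nmem m' k 0 = i ->
    runs (While (nlt (cell k) (cell 0))
      (Seq body (NWrite k (NConst 0) (NAdd (cell k) (NConst 1))))) m'
      (6 + \sum_(i <= l < n) (T l + 12)) (Inv n).
  elim: j i m' => [|j IH] i m' ij Im mk.
    rewrite addn0 in ij; rewrite ij in Im mk *.
    exists 6%N, m'; split; [|exact: leq_addr|exact: Im].
    apply: (@ExecWhileFalse _ (nlt (cell k) (cell 0))).
    by rewrite /= (Invn _ _ Im) mk leqnn.
  have ltin : (i < n)%N by lia.
  have [t1 [m1 [ex1 tt1 [I1 k1]]]] := step i m' ltin Im mk.
  have e1 : i.+1 = (nmem m1 k 0 + 1)%N by rewrite k1 addn1.
  have [|||t2 [m2 [ex2 tt2 I2]]] := IH i.+1 (set_cell m1 k 0 i.+1).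
  - by rewrite -ij addnS.
  - exact: Invk.
  - by rewrite /= /upd !eqxx.
  exists (6 + (t1 + 6) + t2)%N, m2; split=> //.
    apply: (@ExecWhileTrue _ _ _ m' (t1 + 6) (set_cell m1 k 0 i.+1)) => //.
      by rewrite /= (Invn _ _ Im) mk -ltnNge.
    apply: ExecSeq ex1 _; rewrite e1.
    exact: (ExecNWrite k (NConst 0) (NAdd (cell k) (NConst 1)) m1).
  by rewrite big_ltn//; lia.
rewrite -(big_mkord xpredT (fun i => T i + 12)%N) -[9%N]/(3 + 6)%N -addnA.
apply: (runs_seq (Q1 := fun m' => Inv 0%N m' /\ nmem m' k 0 = 0%N)).
  apply: runs_nwrite; split; first exact: Invk.
  by rewrite /= /upd !eqxx.
by move=> m' [Im mk]; exact: (loop n 0%N).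
Qed.

End runs.

(** * A program that computes the candidates *)

(** The program uses cell 0 of the natural arrays 3, 4 and 5 as loop counters
and of the arrays 7 and 8 to count the vertices ahead and behind; array 6 holds
the flags of the covered vertices. *)
Definition rpos (e : nexp) : rexp := RRead 1 e.

Definition rlt (e1 e2 : rexp) : bexp := BNot (BRLe e2 e1).

Definition bor (b1 b2 : bexp) : bexp := BNot (BAnd (BNot b1) (BNot b2)).

Definition bcloser (a v b : nexp) : bexp :=
  rlt (RDist (rpos a) (rpos v)) (RDist (rpos a) (rpos b)).

Definition rthird : rexp := RDiv (ROfNat (NConst 1)) (ROfNat (NConst 3)).

Definition bahead (v w : nexp) : bexp :=
  bor (BAnd (BRLe (rpos v) (rpos w)) (rlt (RSub (rpos w) (rpos v)) rthird))
      (BAnd (BNot (BRLe (rpos v) (rpos w)))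
        (rlt (RAdd (RSub (rpos w) (rpos v)) (ROfNat (NConst 1))) rthird)).

Definition bfew (k : nat) : bexp :=
  rlt (RMul (ROfNat (cell k)) (RLn (ROfNat (cell k))))
      (RMul (ROfNat (NConst 4))
        (RLn (RDiv (ROfNat (NConst 1)) (RRead 0 (NConst 0))))).

Definition mark : cmd :=
  If (BAnd (bcloser (cell 3) (cell 5) (cell 4))
           (bcloser (cell 4) (cell 5) (cell 3)))
    (NWrite 6 (cell 5) (NConst 1)) Skip.

(** The entry of the adjacency matrix is tested before the loop over the
vertices, which is therefore run once per edge only. *)
Definition mark_edge : cmd :=
  If (BNLe (NConst 1) (NRead 1 (NAdd (NMul (cell 3) (cell 0)) (cell 4))))
    (for_loop 5 mark) Skip.

Definition mark_covered : cmd := for_loop 3 (for_loop 4 mark_edge).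

Definition incr (k : nat) : cmd :=
  NWrite k (NConst 0) (NAdd (cell k) (NConst 1)).

Definition count_one : cmd :=
  If (BAnd (BNLe (NRead 6 (cell 5)) (NConst 0))
           (BNot (BAnd (BNLe (cell 5) (cell 3)) (BNLe (cell 3) (cell 5)))))
    (Seq (If (bahead (cell 3) (cell 5)) (incr 7) Skip)
         (If (bahead (cell 5) (cell 3)) (incr 8) Skip))
    Skip.

Definition decide : cmd :=
  If (BNLe (NRead 6 (cell 3)) (NConst 0))
    (Seq (NWrite 7 (NConst 0) (NConst 0))
    (Seq (NWrite 8 (NConst 0) (NConst 0))
    (Seq (for_loop 5 count_one)
      (If (bor (bfew 7) (bfew 8)) (NWrite 2 (cell 3) (NConst 1)) Skip))))
    Skip.

Definition program : cmd := Seq mark_covered (for_loop 3 decide).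

Lemma card_below n (P : pred 'I_n) (w : 'I_n) :
  #|[set u : 'I_n | (u < w.+1)%N && P u]%SET| =
  (#|[set u : 'I_n | (u < w)%N && P u]%SET| + P w)%N.
Proof.
rewrite (cardsD1 w) inE ltnSn /= addnC; congr (_ + _)%N.
apply: eq_card => u; rewrite !inE ltnS.
by rewrite [in RHS]ltn_neqAle -val_eqE andbA.
Qed.

Section execution.
Context (R : realType) (n : nat) (x : n.-tuple R) (E : {set 'I_n * 'I_n}).
Context (eps : R).
Implicit Types (m : memory R).

Let input := input_memory eps x E.

(** The input is never overwritten. *)
Record base m : Prop := {
  base_n : nmem m 0 0 = n;
  base_adj : forall i, nmem m 1 i = nmem input 1 i;
  base_rmem : rmem m = rmem input }.

Lemma base_set m a i v : (1 < a)%N -> base m -> base (set_cell m a i v).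
Proof.
by case: a => [|[|a]]// _ [bn ba br]; split.
Qed.

(** The entries of the matrix are indexed by [a * n + b], which determines [a]
and [b]. *)
Lemma adjE (a b : 'I_n) : nmem input 1 (a * n + b)%N = ((a, b) \in E) :> nat.
Proof.
rewrite /=; congr (nat_of_bool _).
apply/existsP/idP => [[[c e] /andP[ceE /eqP /= ab]]|abE].
  have /andP[/eqP ac /eqP be] : (a == c :> nat) && (b == e :> nat).
    have := ltn_ord b; have := ltn_ord e => en bn.
    have n0 : (0 < n)%N by lia.
    have := congr1 (modn^~ n) ab; rewrite !modnMDl !modn_small// => be.
    by rewrite be eqxx andbT -(eqn_pmul2r n0) -(eqn_add2r e) -{1}be ab.
  by rewrite (val_inj ac) (val_inj be).
by exists (a, b); rewrite abE /=.
Qed.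

Lemma base_pos m (v : 'I_n) : base m -> rmem m 1 v = tnth x v.
Proof. by move=> bm; rewrite (base_rmem bm) /= -tnth_nth. Qed.

Lemma beval_closer m ea ev eb (a v b : 'I_n) : base m ->
  neval m ea = a -> neval m ev = v -> neval m eb = b ->
  beval m (bcloser ea ev eb) = closer x a v b.
Proof.
move=> bm ma mv mb; rewrite /bcloser /rlt [LHS]/= -ltNge.
by rewrite ma mv mb !base_pos.
Qed.

Lemma beval_ahead m ev ew (v w : 'I_n) : base m ->
  neval m ev = v -> neval m ew = w ->
  beval m (bahead ev ew) = ahead x v w.
Proof.
move=> bm mv mw; rewrite /bahead /bor [LHS]/= -!ltNge.
rewrite mv mw !base_pos//.
rewrite /ahead /offset.
by case: (leP (tnth x v) (tnth x w)) => _ /=; rewrite ?andbT negbK.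
Qed.

(** This is where the count is compared with [K] without computing [K]. *)
Lemma beval_few m k (K := threshold (4%:R * ln (1 / eps))) : base m ->
  beval m (bfew k) = (nmem m k 0 < K)%N.
Proof.
by move=> bm; rewrite ltn_threshold /bfew /rlt [LHS]/= -ltNge (base_rmem bm).
Qed.

Definition spans (a b v : 'I_n) : bool := closer x a v b && closer x b v a.

Definition flags m (k : nat) (S : 'I_n -> bool) : Prop :=
  forall v : 'I_n, (nmem m k v != 0%N) = S v.

Lemma flags_set_true m k S (w : 'I_n) : flags m k S ->
  flags (set_cell m k w 1) k (fun v => S v || (v == w)).
Proof.
move=> fS u; rewrite /= /upd eqxx /= val_eqE.
by case: (u == w) => /=; rewrite ?orbT ?orbF ?fS.
Qed.

Lemma flags_ext m k S S' : S =1 S' -> flags m k S -> flags m k S'.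
Proof. by move=> SS' fS u; rewrite fS SS'. Qed.

Lemma run_mark m (a b : 'I_n) S :
  base m -> nmem m 3 0 = a -> nmem m 4 0 = b -> flags m 6 S ->
  flags m 2 xpred0 ->
  runs (for_loop 5 mark) m (9 + 49 * n) (fun m' =>
    [/\ base m', nmem m' 3 0 = a, nmem m' 4 0 = b,
        flags m' 6 (fun v => S v || spans a b v) & flags m' 2 xpred0]).
Proof.
move=> bm ma mb fS f2.
pose Inv (i : nat) m' := [/\ base m', nmem m' 3 0 = a, nmem m' 4 0 = b,
  flags m' 6 (fun v => S v || ((v < i)%N && spans a b v)) & flags m' 2 xpred0].
apply: (@runs_weaken _ _ _ (9 + \sum_(i < n) (37 + 12)) _ (Inv n)).
- by rewrite sum_nat_const card_ord; lia.
- move=> m' [? ? ? fn ?]; split=> //; apply: flags_ext fn => v.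
  by rewrite ltn_ord.
apply: (runs_for (T := fun=> 37%N)).
- by move=> i m' [[]].
- by move=> i m' v [b' ? ? ? ?]; split=> //; exact: base_set.
- move=> i m' ltin [b' ma' mb' f6 f2'] m5.
  pose w := Ordinal ltin.
  have below (v : 'I_n) : (v < i.+1)%N = (v == w) || (v < i)%N.
    by rewrite ltnS leq_eqVlt.
  have m5w : nmem m' 5 0 = w by [].
  have condE : beval m' (BAnd (bcloser (cell 3) (cell 5) (cell 4))
      (bcloser (cell 4) (cell 5) (cell 3))) = spans a b w.
    transitivity (beval m' (bcloser (cell 3) (cell 5) (cell 4)) &&
      beval m' (bcloser (cell 4) (cell 5) (cell 3))); first by [].
    by rewrite (beval_closer (a := a) (v := w) (b := b))//
      (beval_closer (a := b) (v := w) (b := a)).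
  apply: (@runs_if _ _ _ _ _ 4); rewrite condE => sp.
    apply: runs_nwrite; rewrite /= m5; split=> //; split=> //.
    - exact: base_set.
    - apply: flags_ext (flags_set_true w f6) => v; rewrite below.
      by case: (eqVneq v w) => [->|_] /=; rewrite ?sp ?orbT ?orbF.
  apply: runs_skip; split=> //; split=> //.
  apply: flags_ext f6 => v; rewrite below.
  by case: (eqVneq v w) => [->|_] //=; rewrite (negbTE sp) andbF.
by split=> //; apply: flags_ext fS => v; rewrite ltn0 orbF.
Qed.

(** The term [#|E| * (9 + 49 * n)] accounts for the innermost loop; a bound of
[n] runs for each [a] would only give cubic time. *)
Lemma run_mark_covered m :
  base m -> flags m 6 xpred0 -> flags m 2 xpred0 ->
  runs mark_covered m (9 + 21 * n + 23 * n ^ 2 + #|E| * (9 + 49 * n))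
    (fun m' => [/\ base m', flags m' 6 (covered x E) & flags m' 2 xpred0]).
Proof.
move=> bm f6 f2.
pose S (a : nat) v := [exists e in E, (e.1 < a)%N && spans e.1 e.2 v].
pose Sb (a b : nat) v :=
  [exists e in E, (e.1 == a :> nat) && (e.2 < b)%N && spans e.1 e.2 v].
pose Inva (a : nat) m' := [/\ base m', flags m' 6 (S a) & flags m' 2 xpred0].
pose c := (9 + 49 * n)%N.
pose Tb (a b : nat) := (11 + nmem input 1 (a * n + b) * c)%N.
pose Ta a := (9 + \sum_(b < n) (Tb a b + 12))%N.
apply: (@runs_weaken _ _ _ (9 + \sum_(a < n) (Ta a + 12)) _ (Inva n)).
- rewrite /Ta /Tb.
  have sumE : (\sum_(a < n) \sum_(b < n) nmem input 1 (a * n + b) = #|E|)%N.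
    rewrite pair_bigA -sum1_card [RHS]big_mkcond; apply: eq_bigr => -[a b] _.
    by transitivity (nat_of_bool ((a, b) \in E)); [exact: adjE|case: (_ \in E)].
  have split_sum (a : 'I_n) : (9 + \sum_(b < n)
      (11 + nmem input 1 (a * n + b) * c + 12) + 12 =
      (21 + 23 * n) + (\sum_(b < n) nmem input 1 (a * n + b)) * c)%N.
    rewrite (eq_bigr (fun b : 'I_n => 23 + nmem input 1 (a * n + b) * c))%N.
      by rewrite big_split /= sum_nat_const card_ord big_distrl /=; lia.
    by move=> b _; lia.
  under eq_bigr do rewrite split_sum.
  rewrite big_split /= sum_nat_const card_ord -big_distrl /= sumE.
  by rewrite -/c expnS expn1; apply: eq_leq; ring.
- move=> m' [? f6' ?]; split=> //; apply: flags_ext f6' => v.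
  by rewrite /S /covered; apply: eq_existsb => e; rewrite ltn_ord.
apply: runs_for.
- by move=> i m' [[]].
- by move=> i m' v [b' ? ?]; split=> //; exact: base_set.
- move=> i m' ltin [b' f6' f2'] m3; pose a := Ordinal ltin.
  pose Invb (b : nat) m'' := [/\ base m'', nmem m'' 3 0 = a,
    flags m'' 6 (fun v => S i v || Sb i b v) & flags m'' 2 xpred0].
  apply: (@runs_weaken _ _ _ _ _ (Invb n)) (leqnn _) _ _.
    move=> m'' [? ? f6'' ?]; split=> //; split=> //.
    apply: flags_ext f6'' => v; apply/orP/existsP.
      move=> [|] /existsP[e /andP[eE]].
        by move=> /andP[ei sp]; exists e; rewrite eE sp ltnS ltnW.
      move=> /andP[/andP[/eqP ei _] sp]; exists e.
      by rewrite eE sp ltnS ei leqnn.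
    move=> [e /andP[eE /andP[]]]; rewrite ltnS leq_eqVlt => /orP[ei|ei] sp.
      by right; apply/existsP; exists e; rewrite eE ei sp ltn_ord.
    by left; apply/existsP; exists e; rewrite eE ei.
  apply: runs_for.
  + by move=> j m'' [[]].
  + by move=> j m'' v [b'' ? ? ?]; split=> //; exact: base_set.
  + move=> j m'' ltjn [b'' m3'' f6'' f2''] m4; pose b := Ordinal ltjn.
    have adj : neval m'' (NRead 1 (NAdd (NMul (cell 3) (cell 0)) (cell 4))) =
        ((a, b) \in E).
      by rewrite /= m3'' m4 (base_n b'') (base_adj b'') -adjE.
    have SbS v : (S i v || Sb i j.+1 v) =
        (S i v || Sb i j v) || (((a, b) \in E) && spans a b v).
      rewrite -orbA; congr (_ || _); apply/existsP/orP.
        move=> [e /andP[eE /andP[/andP[ei]]]]; rewrite ltnS leq_eqVlt.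
        move=> /orP[ej|ej] sp; last first.
          by left; apply/existsP; exists e; rewrite eE ei ej.
        have -> : a = e.1 by apply: ord_inj; apply/esym/eqP.
        have -> : b = e.2 by apply: ord_inj; apply/esym/eqP.
        by right; rewrite -surjective_pairing eE.
      move=> [/existsP[e /andP[eE /andP[/andP[ei ej] sp]]]|/andP[abE sp]].
        by exists e; rewrite eE ei sp ltnS ltnW.
      by exists (a, b); rewrite abE /= eqxx ltnSn.
    apply: (@runs_if _ _ _ _ _ (nmem input 1 (i * n + j) * c)); last first.
      move=> nadj; apply: runs_skip; split=> //.
      split=> //; apply: flags_ext f6'' => v; rewrite SbS.
      move: nadj; rewrite -[beval _ _]/(1 <= neval m'' _)%N adj.
      by case: (_ \in E) => //; rewrite orbF.
    rewrite -[beval _ _]/(1 <= neval m'' _)%N adj -[i]/(nat_of_ord a)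
      -[j]/(nat_of_ord b) adjE => adjab.
    have abE : (a, b) \in E by case: (_ \in E) adjab.
    have run := @run_mark m'' a b _ b'' m3'' m4 f6'' f2''.
    apply: (runs_weaken _ _ run).
      by rewrite abE mul1n.
    move=> m1 [b1 m31 m41 f61 f21]; split=> //; split=> //.
    by apply: flags_ext f61 => v; rewrite SbS abE.
  + have Sb0 v : Sb i 0%N v = false.
      by apply/negbTE/existsP => -[e]; rewrite ltn0 !(andbF, andFb).
    by split=> //; apply: flags_ext f6' => v; rewrite Sb0 orbF.
have S0 v : S 0%N v = false.
  by apply/negbTE/existsP => -[e]; rewrite ltn0 !(andbF, andFb).
by split=> //; apply: flags_ext f6 => v; rewrite S0.
Qed.

End execution.

Section decision.
Context (R : realType) (n : nat) (x : n.-tuple R) (E : {set 'I_n * 'I_n}).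
Context (eps : R).
Implicit Types (m : memory R).

Let input := input_memory eps x E.
Let K := threshold (4%:R * ln (1 / eps)).
Let base := @base R n x E eps.
Let cov := covered x E.
Let H := candidates K x E.

Definition seen_before (P : 'I_n -> bool) (i : nat) : nat :=
  #|[set u : 'I_n | (u < i)%N && P u]%SET|.

Lemma run_count m (v : 'I_n) (S : 'I_n -> bool) (t := (9 + 146 * n)%N) :
  base m -> nmem m 3 0 = v -> flags m 6 cov -> flags m 2 S ->
  nmem m 7 0 = 0%N -> nmem m 8 0 = 0%N ->
  runs (for_loop 5 count_one) m t (fun m' =>
    [/\ base m', nmem m' 3 0 = v, flags m' 6 cov & flags m' 2 S] /\
    nmem m' 7 0 = #|seen_ahead x E v| /\ nmem m' 8 0 = #|seen_behind x E v|).
Proof.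
move=> bm m3 f6 f2 m7 m8.
pose pa u := [&& ~~ cov u, u != v & ahead x v u].
pose pb u := [&& ~~ cov u, u != v & ahead x u v].
pose Inv i m' := [/\ base m', nmem m' 3 0 = v, flags m' 6 cov & flags m' 2 S] /\
  nmem m' 7 0 = seen_before pa i /\ nmem m' 8 0 = seen_before pb i.
have seen_all (p : pred 'I_n) : seen_before p n = #|[set u | p u]%SET|.
  by apply: eq_card => u; rewrite !inE ltn_ord.
have seen_none (p : pred 'I_n) : seen_before p 0 = 0%N.
  by apply/eqP; rewrite cards_eq0; apply/eqP/setP => u; rewrite !inE ltn0.
apply: (@runs_weaken _ _ _ (9 + \sum_(i < n) (134 + 12)) _ (Inv n)).
- by rewrite sum_nat_const card_ord /t mulnC.
- by move=> m' []; rewrite !seen_all.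
apply: (runs_for (T := fun=> 134%N)).
- by move=> i m' [[[]]].
- by move=> i m' u [[b' ? ? ?] ?]; split=> //; split=> //; exact: base_set.
- move=> i m' ltin [[b' m3' f6' f2'] [m7' m8']] m5; pose w := Ordinal ltin.
  have m5w : nmem m' 5 0 = w by [].
  have seenS (p : pred 'I_n) : seen_before p i.+1 = (seen_before p i + p w)%N.
    exact: (card_below p w).
  pose guard := BAnd (BNLe (NRead 6 (cell 5)) (NConst 0))
    (BNot (BAnd (BNLe (cell 5) (cell 3)) (BNLe (cell 3) (cell 5)))).
  have guardE : beval m' guard = ~~ cov w && (w != v).
    by rewrite /= m5w m3' leqn0 -f6' negbK -eqn_leq.
  apply: (@runs_if _ guard _ _ _ 116); rewrite guardE => gw; last first.
    apply: runs_skip; split=> //; split=> //.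
    have pa0 : pa w = false by rewrite /pa andbA (negbTE gw).
    have pb0 : pb w = false by rewrite /pb andbA (negbTE gw).
    by rewrite !seenS pa0 pb0 !addn0.
  have /andP[ncw wv] := gw.
  have paE : pa w = ahead x v w by rewrite /pa ncw wv.
  have pbE : pb w = ahead x w v by rewrite /pb ncw wv.
  pose mid m'' :=
    [/\ base m'', nmem m'' 3 0 = v, flags m'' 6 cov & flags m'' 2 S] /\
    nmem m'' 5 0 = i /\
    nmem m'' 7 0 = seen_before pa i.+1 /\ nmem m'' 8 0 = seen_before pb i.
  apply: (@runs_seq _ _ _ _ 58 58 mid).
    apply: (@runs_if _ _ _ _ _ 6);
      rewrite (beval_ahead (v := v) (w := w) b')// -paE => aw.
      apply: runs_nwrite; split; first by split=> //; exact: base_set.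
      by rewrite /= /upd /= m7' m5 m8' seenS aw.
    apply: runs_skip; split=> //; split=> //.
    by rewrite seenS (negbTE aw) addn0.
  move=> m'' [[b'' m3'' f6'' f2''] [m5'' [m7'' m8'']]].
  have m5w'' : nmem m'' 5 0 = w by [].
  apply: (@runs_if _ _ _ _ _ 6);
    rewrite (beval_ahead (v := w) (w := v) b'')// -pbE => aw.
    apply: runs_nwrite; split; last by [].
    split; first by split=> //; exact: base_set.
    by rewrite /= /upd /= m7'' m8'' [seen_before pb i.+1]seenS aw.
  apply: runs_skip; split=> //; split=> //.
  by rewrite [seen_before pb i.+1]seenS (negbTE aw) addn0.
by split=> //; rewrite !seen_none.
Qed.

Lemma run_decide m (S : 'I_n -> bool) (v : 'I_n) :
  base m -> nmem m 3 0 = v -> flags m 6 cov -> flags m 2 S ->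
  runs decide m (66 + 146 * n) (fun m' =>
    [/\ base m', nmem m' 3 0 = v, flags m' 6 cov &
        flags m' 2 (fun u => S u || ((u == v) && (v \in H)))]).
Proof.
move=> bm m3 f6 f2.
have -> : (66 + 146 * n = 5 + (3 + (3 + ((9 + 146 * n) + 46))))%N by lia.
have HE : v \in H = ~~ cov v &&
  ((#|seen_ahead x E v| < K)%N || (#|seen_behind x E v| < K)%N) by rewrite inE.
have fneq (b : bool) : b = false -> flags m 2 (fun u => S u || ((u == v) && b)).
  by move=> ->; apply: flags_ext f2 => u; rewrite andbF orbF.
apply: runs_if => cv; last first.
  apply: runs_skip; split=> //; apply: fneq; rewrite HE.
  by move: cv; rewrite /= m3 leqn0 -f6 => ->.
have ncv : ~~ cov v by move: cv; rewrite /= m3 leqn0 -f6 negbK.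
pose keep m' := [/\ base m', nmem m' 3 0 = v, flags m' 6 cov & flags m' 2 S].
(* Both counters are reset, then the vertices are counted and the counts
   compared with the threshold. *)
apply: (@runs_seq _ _ _ _ 3 _ (fun m' => keep m' /\ nmem m' 7 0 = 0%N)).
  by apply: runs_nwrite; split=> //; split=> //; exact: base_set.
move=> m1 [[b1 m31 f61 f21] m71].
apply: (@runs_seq _ _ _ _ 3 _ (fun m' =>
    keep m' /\ nmem m' 7 0 = 0%N /\ nmem m' 8 0 = 0%N)).
  by apply: runs_nwrite; split=> //; split=> //; exact: base_set.
move=> m2 [[b2 m32 f62 f22] [m72 m82]].
apply: (runs_seq (run_count b2 m32 f62 f22 m72 m82)).
move=> m4 [[b4 m34 f64 f24] [m74 m84]].
have fewE : beval m4 (bor (bfew 7) (bfew 8)) = (v \in H).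
  transitivity (beval m4 (bfew 7) || beval m4 (bfew 8)).
    by rewrite -[LHS]/(~~ (~~ beval m4 (bfew 7) && ~~ beval m4 (bfew 8)))
      negb_and !negbK.
  by rewrite HE ncv !(beval_few _ b4) m74 m84.
apply: (@runs_if _ _ _ _ _ 4); rewrite fewE => vH.
  apply: runs_nwrite; split=> //; first exact: base_set.
  rewrite /= m34; apply: flags_ext (flags_set_true v f24) => u.
  by rewrite vH andbT.
apply: runs_skip; split=> //; apply: flags_ext f24 => u.
by rewrite (negbTE vH) andbF orbF.
Qed.

(** With [#|E| <= 2 * n], the loops take at most
[18 + 117 * n + 267 * n ^ 2] operations. *)
Lemma program_returns (b : R) :
  (0 < n)%N -> (#|E| <= 2 * n)%N -> (402 * n ^ 2)%:R <= b ->
  returns_within program eps x E b H.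
Proof.
move=> n0 En tb.
have b0 : base input by [].
have f6 : flags input 6 (xpred0 : pred 'I_n) by [].
have f2 : flags input 2 (xpred0 : pred 'I_n) by [].
pose Inv (i : nat) m := [/\ base m, flags m 6 cov &
  flags m 2 (fun u => (u < i)%N && (u \in H))].
have [t [m [ex tm [bm _ f2m]]]] : runs program input (402 * n ^ 2) (Inv n).
  apply: (@runs_weaken _ _ _ ((9 + 21 * n + 23 * n ^ 2 + #|E| * (9 + 49 * n)) +
    (9 + \sum_(i < n) ((66 + 146 * n) + 12))) _ (Inv n)) => //.
    rewrite sum_nat_const card_ord.
    have : (#|E| * (9 + 49 * n) <= 2 * n * (9 + 49 * n))%N.
      by rewrite leq_mul2r En orbT.
    have : (n <= n ^ 2)%N by rewrite expnS expn1 leq_pmulr.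
    have : (1 <= n ^ 2)%N by rewrite expn_gt0 n0.
    by rewrite expnS expn1; nia.
  apply: (runs_seq (run_mark_covered b0 f6 f2)) => m' [b' f6' f2'].
  apply: (runs_for (T := fun=> (66 + 146 * n)%N)).
  - by move=> i m1 [[]].
  - by move=> i m1 v [b1 ? ?]; split=> //; exact: base_set.
  - move=> i m1 ltin [b1 f61 f21] m31; pose v := Ordinal ltin.
    have m3v : nmem m1 3 0 = v by [].
    apply: (runs_weaken (leqnn _) _ (run_decide b1 m3v f61 f21)).
    move=> m2 [b2 m32 f62 f22]; split=> //; split=> //.
    apply: flags_ext f22 => u.
    have -> : (u < i.+1)%N = (u == v) || (u < i)%N by rewrite ltnS leq_eqVlt.
    by case: (eqVneq u v) => [->|_] //=; rewrite ?ltnn ?orbF.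
  - by split=> //; apply: flags_ext f2' => u; rewrite ltn0.
exists t, m; split=> //.
  by apply: le_trans tb; rewrite ler_nat.
apply/setP => v; rewrite inE f2m.
by rewrite ltn_ord.
Qed.

End decision.

(** * The theorem *)

Lemma card_tree_edges (n : nat) (p : 'I_n -> 'I_n) :
  (#|tree_edges p| <= 2 * n)%N.
Proof.
have sub : tree_edges p \subset
    [set (i, p i) | i : 'I_n]%SET :|: [set (p i, i) | i : 'I_n]%SET.
  apply/fintype.subsetP => -[a b]; rewrite !inE /=.
  by move=> /orP[/andP[_ /eqP <-]|/andP[_ /eqP <-]]; rewrite imset_f ?orbT.
apply: leq_trans (subset_leq_card sub) _.
apply: leq_trans (leq_card_setU _ _) _.
rewrite mul2n -addnn leq_add//;
  by apply: leq_trans (leq_imset_card _ _) _; rewrite card_ord.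
Qed.

Lemma card_rename_edges (n : nat) (s : 'S_n) (E : {set 'I_n * 'I_n}) :
  #|rename_edges s E| = #|E|.
Proof.
have inj : injective (fun e : 'I_n * 'I_n => (s e.1, s e.2)).
  by move=> [a b] [c e] [/perm_inj -> /perm_inj ->].
rewrite -(card_imset _ inj); apply: eq_card => -[a b].
apply/imsetP/idP => [[e + ->]|abE]; first by rewrite inE.
exists ((s^-1)%g a, (s^-1)%g b); last by rewrite /= !permKV.
by rewrite inE /= !permKV.
Qed.

Theorem mainTheorem1 (R : realType) :
  exists c1 c2 eps0 : R,
    [/\ 0 < c1, 0 < c2 & 0 < eps0] /\
    (* upper bound *)
    (exists (prog : cmd) (C : R) (H : R -> procedure R),
       forall eps : R, 0 < eps < eps0 ->
         [/\ embedded_procedure (H eps),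
             forall (n : nat) (x : n.-tuple R) (E : {set 'I_n * 'I_n}),
               (0 < n)%N -> is_embedded_nn_tree x E ->
               returns_within prog eps x E
                 (C * (n%:R ^+ 2 + ln (1 / eps) ^+ 2)) (H eps n x E) /\
               size_log_size R (H eps n x E) <= c1 * ln (1 / eps)
           & forall (d : measure_display) (T : measurableType d)
               (P : probability T R) (X : nat -> {RV P >-> R}),
               uniform_positions X -> finds_root X eps (H eps)]) /\
    (* lower bound *)
    (forall eps : R, 0 < eps < eps0 ->
       forall (d : measure_display) (T : measurableType d)
         (P : probability T R) (X : nat -> {RV P >-> R}),
         uniform_positions X ->
         ~ exists H : procedure R,
             [/\ embedded_procedure H,
                 forall (n : nat) (x : n.-tuple R) (E : {set 'I_n * 'I_n}),
                   (0 < n)%N -> is_embedded_nn_tree x E ->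
                   size_log_size R (H n x E) < c2 * ln (1 / eps)
               & finds_root X eps H]).
Proof.
(* The lower bound uses that ln (1 / eps) exceeds 6 * nlogn 3, and the upper
   bound that K exceeds 128 ^ 2; the sum of both conditions is imposed. *)
pose eps0 : R := expR (- (6 * nlogn R 3 + nlogn R (128 ^ 2))).
have large eps : 0 < eps < eps0 ->
    6 * nlogn R 3 + nlogn R (128 ^ 2) < ln (1 / eps).
  move=> /andP[e0 elt]; rewrite div1r lnV ?posrE// ltrNr.
  by rewrite -ltr_expR lnK ?posrE.
have n3 := nlogn_ge0 R 3; have n128 := nlogn_ge0 R (128 ^ 2).
exists 144%:R, 6^-1, eps0; split.
  by split; rewrite ?expR_gt0 ?invr_gt0.
split.
  exists program, 402%:R,
    (fun eps => candidates (threshold (4%:R * ln (1 / eps)))) => eps eps01.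
  have L := large eps eps01; have /andP[e0 _] := eps01.
  have K128 : (128 ^ 2 < threshold (4%:R * ln (1 / eps)))%N.
    by rewrite ltn_threshold; move: L n3 n128; lra.
  split.
  - by split; [exact: label_invariant_candidates|exact: measurable_candidates].
  - move=> n x E n0 [x01 [s [p [_ pE]]]]; split.
      apply: program_returns => //.
        by rewrite -(card_rename_edges s) pE; exact: card_tree_edges.
      rewrite natrM natrX; apply: ler_wpM2l; first exact: ler0n.
      by rewrite lerDl exprn_even_ge0.
    apply: candidates_size => //.
    by apply: leq_ltn_trans K128.
  - by move=> d T P X unifX; exact: candidates_find_root.
move=> eps eps01 d T P X unifX; apply: no_small_procedure => //.
  by case/andP: eps01.
by have := large eps eps01; move: n3 n128; lra.
Qed.
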